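(* Assume in addition $\rho_0\in L^1([0,\infty))$. Then for all $t>0$ the total mass is conserved: $$\int_{[0,\infty)}\rho(dx,t)=\int_0^\infty\rho_0(x)\,dx+\int_0^t\rho_b(\eta)u_b(\eta)\,d\eta,$$ and for the total momentum $$\int_{[0,\infty)}u(x,t)\,\rho(dx,t)\ \begin{cases}=\int_0^\infty\rho_0u_0\,dx+\int_0^t\rho_b u_b^2\,d\eta,& \text{if } F(0,t)\ge G(0,t),\\ \ge\int_0^\infty\rho_0u_0\,dx-\int_0^t\rho_bu_b^2\,d\eta,&\text{if } F(0,t)<G(0,t).\end{cases}$$
   Context: Standing assumptions: $u_0,u_b:[0,\infty)\to\mathbb{R}$ bounded measurable with $u_b>0$; $\rho_0,\rho_b:[0,\infty)\to(0,\infty)$ positive locally bounded measurable. For $x,t,y,\tau\ge0$: $F(y,x,t)=\int_0^y[tu_0(\eta)+\eta-x]\rho_0(\eta)\,d\eta$, $G(\tau,x,t)=\int_0^\tau[x-u_b(\eta)(t-\eta)]\rho_b(\eta)u_b(\eta)\,d\eta$, $F(x,t)=\min_{y\ge0}F(y,x,t)$, $G(x,t)=\min_{\tau\ge0}G(\tau,x,t)$ (minima attained); $y_*\le y^*$ the smallest/largest minimizers of $F(\cdot,x,t)$, $\tau_*\le\tau^*$ those of $G(\cdot,x,t)$. Definition of $u$: for $x,t>0$: (a) if $F(x,t)<G(x,t)$, $y_*=y^*$: $u=\frac{x-y_*}{t}$; (b) if $F<G$, $y_*<y^*$: $u=\frac{\int_{y_*}^{y^*}\rho_0u_0}{\int_{y_*}^{y^*}\rho_0}$;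 (c) if $F>G$, $\tau_*=\tau^*$: $u=\frac{x}{t-\tau_*}$; (d) if $F>G$, $\tau_*<\tau^*$: $u=\frac{\int_{\tau_*}^{\tau^*}\rho_bu_b^2}{\int_{\tau_*}^{\tau^*}\rho_bu_b}$; (e) if $F=G$ and ($y^*\ne0$ or $\tau^*\ne0$): $u=\frac{\int_0^{\tau^*}\rho_bu_b^2+\int_0^{y^*}\rho_0u_0}{\int_0^{\tau^*}\rho_bu_b+\int_0^{y^*}\rho_0}$; (f) if $F=G$, $y^*=\tau^*=0$: $u=x/t$. For $x=0$: $u(0,t)=u_b(t)$ if $F(0,t)>G(0,t)$, $0$ if $F(0,t)<G(0,t)$, formula (e) with $x=0$ if $F(0,t)=G(0,t)$. Definition of $m$ ($t>0,x\ge0$): $m=\int_0^{y_*(x,t)}\rho_0$ if $x>0$ and $F(x,t)\le G(x,t)$; $m=-\int_0^{\tau_*(x,t)}\rho_bu_b$ if $F(x,t)>G(x,t)$ or $x=0$. The measure $\rho(\cdot,t)$ on $[0,\infty)$: on $(0,\infty)$ it is the Lebesgue–Stieltjes measure $m(dx,t)$ of $x\mapsto m(x,t)$ (i.e. $\partial_xm$); at $x=0$ it has an atom $\big(\lim_{x\searrow0}m(x,t)-m(0,t)\big)\delta_0$ if $F(0,t)\le G(0,t)$, and no atom if $F(0,t)>G(0,t)$. Thus $\int_{[0,\infty)}u\,\rho(dx,t)=\int_{(0,\infty)}u\,m(dx,t)$ plus $u(0,t)\big(m(0+,t)-m(0,t)\big)$ when $F(0,t)\le G(0,t)$. *)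

(* Defs.v *)
From HB Require Import structures.
From mathcomp Require Import all_boot all_order all_algebra.
From mathcomp Require Import all_classical all_reals all_analysis.
Import Order.TTheory GRing.Theory Num.Theory.
Import numFieldNormedType.Exports.
Local Open Scope classical_set_scope.
Local Open Scope ring_scope.

Set Implicit Arguments.
Unset Strict Implicit.
Unset Printing Implicit Defensive.

Section LS.
Context {R : realType}.

(* right-continuous regularization of a function (for a nondecreasing f this is
   x |-> f(x+)) *)
Definition rreg (f : R -> R) (x : R) : R := inf [set f z | z in `]x, +oo[].

(* Lebesgue--Stieltjes measure df of a nondecreasing function f (built from
   its right-continuous version, as usual).  If rreg f is not a cumulative
   function, we return the zero measure (this case does not occur in the
   situation of the theorem, where m(.,t) is nondecreasing). *)
Definition LSmeasure (f : R -> R) : {measure set (measurableTypeR R) -> \bar R} :=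
  match pselect (nondecreasing (rreg f) /\ right_continuous (rreg f)) with
  | left H => lebesgue_stieltjes_measure
      (HB.pack (rreg f) (isCumulative.Build R _ R (rreg f) (proj1 H) (proj2 H)))
  | right _ => mzero
  end.
End LS.

Section Model.
Context {R : realType}.
Variables (u0 ub rho0 rhob : R -> R).

Local Notation leb := (@lebesgue_measure R).

Definition Ffun (y x t : R) : R :=
  \int[leb]_(eta in `[0, y]) ((t * u0 eta + eta - x) * rho0 eta).
Definition Gfun (tau x t : R) : R :=
  \int[leb]_(eta in `[0, tau]) ((x - ub eta * (t - eta)) * rhob eta * ub eta).

Definition Fmin (x t : R) : R := inf [set Ffun y x t | y in `[0%R, +oo[].
Definition Gmin (x t : R) : R := inf [set Gfun tau x t | tau in `[0%R, +oo[].

Definition Fargmin (x t : R) : set R := [set y | 0 <= y /\ Ffun y x t = Fmin x t].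
Definition Gargmin (x t : R) : set R := [set tau | 0 <= tau /\ Gfun tau x t = Gmin x t].
Definition ylo (x t : R) : R := inf (Fargmin x t).
Definition yhi (x t : R) : R := sup (Fargmin x t).
Definition tlo (x t : R) : R := inf (Gargmin x t).
Definition thi (x t : R) : R := sup (Gargmin x t).

Definition u_e (x t : R) : R :=
  ((\int[leb]_(eta in `[0, thi x t]) (rhob eta * ub eta ^+ 2))
   + \int[leb]_(eta in `[0, yhi x t]) (rho0 eta * u0 eta)) /
  ((\int[leb]_(eta in `[0, thi x t]) (rhob eta * ub eta))
   + \int[leb]_(eta in `[0, yhi x t]) (rho0 eta)).

(* the velocity u(x,t), for t > 0 and x >= 0 (values for x < 0 are irrelevant) *)
Definition ufun (x t : R) : R :=
  if 0 < x then
    if Fmin x t < Gmin x t then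
      if ylo x t == yhi x t then (x - ylo x t) / t
      else (\int[leb]_(eta in `[ylo x t, yhi x t]) (rho0 eta * u0 eta)) /
           (\int[leb]_(eta in `[ylo x t, yhi x t]) (rho0 eta))
    else if Gmin x t < Fmin x t then
      if tlo x t == thi x t then x / (t - tlo x t)
      else (\int[leb]_(eta in `[tlo x t, thi x t]) (rhob eta * ub eta ^+ 2)) /
           (\int[leb]_(eta in `[tlo x t, thi x t]) (rhob eta * ub eta))
    else
      if (yhi x t != 0) || (thi x t != 0) then u_e x t else x / t
  else
    if Gmin x t < Fmin x t then ub t
    else if Fmin x t < Gmin x t then 0
    else u_e x t.

(* the cumulative mass m(x,t), for t > 0 and x >= 0 *)
Definition mfun (x t : R) : R :=
  if (0 < x) && (Fmin x t <= Gmin x t) then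
    \int[leb]_(eta in `[0, ylo x t]) (rho0 eta)
  else - \int[leb]_(eta in `[0, tlo x t]) (rhob eta * ub eta).

Definition m0plus (t : R) : R := lim ((fun x => mfun x t) @ at_right 0).

(* x |-> m(x,t) on (0,oo), extended by the constant m(0+,t) on (-oo,0]
   (the extension only serves to build a measure on R; we only use its
   restriction to (0,oo)) *)
Definition mext (t : R) (x : R) : R := if 0 < x then mfun x t else m0plus t.

Definition mmeas (t : R) := LSmeasure (mext t).

Definition atom0 (t : R) : R :=
  if Fmin 0 t <= Gmin 0 t then m0plus t - mfun 0 t else 0.

Definition total_mass (t : R) : \bar R :=
  (mmeas t `]0%R, +oo[%classic + (atom0 t)%:E)%E.

Definition total_momentum (t : R) : \bar R :=
  (\int[mmeas t]_(x in `]0%R, +oo[) (ufun x t)%:E + (ufun 0 t * atom0 t)%:E)%E.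

End Model.

(* Main.v *)
Require Import Defs.
From HB Require Import structures.
From mathcomp Require Import all_boot all_order all_algebra.
From mathcomp Require Import all_classical all_reals all_analysis.
From mathcomp Require Import measurable_realfun ring lra.
Import Order.TTheory GRing.Theory Num.Theory.
Import numFieldNormedType.Exports.
Local Open Scope classical_set_scope.
Local Open Scope ring_scope.

Set Implicit Arguments.
Unset Strict Implicit.
Unset Printing Implicit Defensive.

(* Label the mass by a real [s]: [s >= 0] is the particle starting at [s], and
   [s < 0] the particle entering at the boundary at time [- s].  With [P], [Q]
   and [H] the primitives (vanishing at 0) of mass, momentum and action along
   the labels, [F(y, x, t) = H y - x P y] and
   [G(tau, x, t) = H (- tau) - x P (- tau)], so that [m (x, t)] is the value of
   [P] at some minimizer of [s |-> H s - x P s].  The largest minimizer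
   [smax x] is nondecreasing, right continuous and tends to infinity, the
   measure [m(dx, t)] of ]a, b] is [P (smax b) - P (smax a)], and the mass
   balance is the limit [b -> oo].

   For the momentum, let [u_n] be the quotient of the increments of
   [Q o smax] and [P o smax] on the cells of a mesh of size 1/(n+1).  Its
   integral telescopes, it is bounded, and it converges almost everywhere to
   [u]: at a jump of [smax] by continuity, elsewhere because
   [dH = (free_time v + start) dP] with [v] the velocity, while optimality gives
   [a dP <= dH <= b dP] on a cell ]a, b].  Dominated convergence concludes. *)

(** * Stieltjes measure of intervals and reflection of Lebesgue integrals *)

Section StieltjesMeasure.
Context {R : realType}.
Implicit Types f : R -> R.

(** On half-open intervals the Caratheodory extension agrees with the length function that it
    extends. *)
Lemma LSmeasure_itv f a b : nondecreasing (rreg f) -> right_continuous (rreg f) ->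
  a <= b -> LSmeasure f `]a, b]%classic = (rreg f b - rreg f a)%:E.
Proof.
move=> nf rf ab; rewrite /LSmeasure; case: pselect => [H|[]//].
rewrite /= /lebesgue_stieltjes_measure /measure_extension measurable_mu_extE/=.
  by rewrite wlength_itv_bnd.
exact: is_ocitv.
Qed.

(** Lebesgue measure is invariant under negation; positive and negative parts are treated separately
    because the pushforward formula used is the one for nonnegative integrands. This turns integrals
    over entry times into integrals over negative labels. *)
Lemma integral_reflect (D : set R) (f : R -> \bar R) : measurable D ->
  measurable_fun D f ->
  (\int[lebesgue_measure]_(x in D) f x =
   \int[lebesgue_measure]_(x in -%R @^-1` D) f (- x)%R)%E.
Proof.
move=> mD mf.
have refl (g : R -> \bar R) : measurable_fun D g -> (forall x, 0 <= g x)%E ->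
  (\int[lebesgue_measure]_(x in D) g x =
   \int[lebesgue_measure]_(x in -%R @^-1` D) g (- x)%R)%E.
  move=> mg g0.
  have := @ge0_integral_pushforward _ _ (measurableTypeR R) (measurableTypeR R) R -%R
    (@oppr_measurable _ setT) lebesgue_measure D g mD mg (fun y _ => g0 y).
  move=> <-; apply: eq_measure_integral => //= A mA _; exact/esym/lebesgue_measureN.
rewrite [LHS]integralE [RHS]integralE; congr (_ - _)%E.
- rewrite (refl f^\+%E) => [||x]; last exact: funepos_ge0.
    by apply: eq_integral => x _; rewrite !funeposE.
  exact: measurable_funepos.
- rewrite (refl f^\-%E) => [||x]; last exact: funeneg_ge0.
    by apply: eq_integral => x _; rewrite !funenegE.
  exact: measurable_funeneg.
Qed.

End StieltjesMeasure.

(** * Primitives of locally bounded densities on the whole line *)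

Section SignedIntegral.
Context {R : realType}.
Implicit Types d : R -> R.
Local Notation leb := (@lebesgue_measure R).

(** A class stable under sums, products, minima and maxima, all of whose members are integrable on
    bounded intervals. *)
Definition locally_bounded_measurable d := measurable_fun [set: R] d /\
  forall T, exists C, forall s, `|s| <= T -> `|d s| <= C.
Local Notation lbm := locally_bounded_measurable.

Lemma lbm_cst c : lbm (cst c).
Proof. by split=> // T; exists `|c|. Qed.

Lemma lbm_id : lbm id.
Proof. by split=> // T; exists T. Qed.

Lemma lbm_add d d' : lbm d -> lbm d' -> lbm (fun s => d s + d' s).
Proof.
move=> [md bd] [md' bd']; split; first exact: measurable_funD.
move=> T; have [C hC] := bd T; have [C' hC'] := bd' T; exists (C + C') => s hs.
by rewrite (le_trans (ler_normD _ _))// lerD ?hC ?hC'.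
Qed.

Lemma lbm_mul d d' : lbm d -> lbm d' -> lbm (fun s => d s * d' s).
Proof.
move=> [md bd] [md' bd']; split; first exact: measurable_funM.
move=> T; have [C hC] := bd T; have [C' hC'] := bd' T; exists (C * C') => s hs.
by rewrite normrM ler_pM ?hC ?hC'.
Qed.

Lemma lbm_min d d' : lbm d -> lbm d' -> lbm (fun s => Num.min (d s) (d' s)).
Proof.
move=> [md bd] [md' bd']; split; first exact: measurable_minr.
move=> T; have [C hC] := bd T; have [C' hC'] := bd' T; exists (Num.max C C').
move=> s hs; rewrite le_max minEle; case: ifPn => _; first by rewrite hC.
by rewrite hC' ?orbT.
Qed.

Lemma lbm_max d d' : lbm d -> lbm d' -> lbm (fun s => Num.max (d s) (d' s)).
Proof.
move=> [md bd] [md' bd']; split; first exact: measurable_maxr.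
move=> T; have [C hC] := bd T; have [C' hC'] := bd' T; exists (Num.max C C').
move=> s hs; rewrite le_max maxEle; case: ifPn => _; last by rewrite hC.
by rewrite hC' ?orbT.
Qed.

Lemma lbm_integrable d a b : lbm d -> leb.-integrable `]a, b] (EFin \o d).
Proof.
move=> [md bd]; apply: measurable_bounded_integrable => //.
- rewrite /= lebesgue_measure_itv/=; case: ifP => // _.
  by rewrite -EFinD ltry.
- exact: measurable_funTS.
have [C hC] := bd (Num.max `|a| `|b|).
exists C; split; first exact: num_real.
move=> C' CC' s; rewrite /= in_itv/= => /andP[as_ sb].
apply: le_trans (ltW CC'); apply: hC; rewrite le_max.
have [s0|s0] := leP 0 s.
  by rewrite (ger0_norm s0) orbC (le_trans sb)// ler_norm.
by rewrite (ltr0_norm s0) -normrN (le_trans _ (ler_norm _))// lerN2 ltW.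
Qed.

Lemma lbm_Rintegral_setU d a b c : lbm d -> a <= b -> b <= c ->
  \int[leb]_(x in `]a, c]) d x =
  \int[leb]_(x in `]a, b]) d x + \int[leb]_(x in `]b, c]) d x.
Proof.
move=> hd ab bc.
have := @Rintegral_itvB _ d (BRight a) (BRight c) b (lbm_integrable a c hd).
by rewrite !bnd_simp => /(_ ab bc) <-; rewrite addrC subrK.
Qed.

(** The primitive vanishing at [0], oriented so that every increment is an integral over a half-open
    interval, also across [0]. *)
Definition signed_integral d s : R :=
  if 0 <= s then \int[leb]_(x in `]0, s]) d x else - \int[leb]_(x in `]s, 0]) d x.
Local Notation K := signed_integral.

Lemma signed_integralB d a b : lbm d -> a <= b ->
  K d b - K d a = \int[leb]_(x in `]a, b]) d x.
Proof.
move=> hd ab; rewrite /K; have [a0|a0] := leP 0 a.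
  rewrite (le_trans a0 ab) (lbm_Rintegral_setU hd a0 ab).
  by rewrite addrC addKr.
have [b0|b0] := leP 0 b.
  by rewrite (lbm_Rintegral_setU hd (ltW a0) b0) opprK addrC.
by rewrite (lbm_Rintegral_setU hd ab (ltW b0)) opprK addrC addrK.
Qed.

Lemma signed_integralD d d' s : lbm d -> lbm d' ->
  K (fun x => d x + d' x) s = K d s + K d' s.
Proof.
move=> hd hd'; rewrite /K; case: ifP => _; rewrite RintegralD ?opprD//;
  exact: lbm_integrable.
Qed.

Lemma signed_integralZ c d s : lbm d -> K (fun x => c * d x) s = c * K d s.
Proof.
move=> hd; rewrite /K; case: ifP => _; rewrite RintegralZl ?mulrN//;
  exact: lbm_integrable.
Qed.

Lemma signed_integral_le d d' a b : lbm d -> lbm d' -> a <= b ->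
  (forall x, a < x <= b -> d x <= d' x) -> K d b - K d a <= K d' b - K d' a.
Proof.
move=> hd hd' ab dd'; rewrite !signed_integralB//.
by apply: le_Rintegral => //; exact: lbm_integrable.
Qed.

(** A zero integral would make the density vanish almost everywhere on an interval of positive
    length. The end points are discarded first, so positivity is only asked in the open interval. *)
Lemma signed_integral_lt d a b : lbm d -> a < b ->
  (forall x, a < x < b -> 0 < d x) -> K d a < K d b.
Proof.
move=> hd ab d0; rewrite -subr_gt0 signed_integralB//; last exact: ltW.
have id := lbm_integrable a b hd.
have ido : leb.-integrable `]a, b[ (EFin \o d).
  by apply: integrableS id => //; apply: subset_itvl; rewrite bnd_simp.
rewrite -Rintegral_itv_bndo_bndc// /Rintegral fine_gt0//.
have mo : measurable (`]a, b[%classic : set (measurableTypeR R)) by exact: measurable_itv.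
have -> /= := integrable_lty mo ido.
rewrite andbT lt_neqAle; apply/andP; split; last first.
  by apply: integral_ge0 => x; rewrite /= in_itv/= => /d0/ltW; rewrite lee_fin.
apply/negP => /eqP/esym i0.
have absE : (\int[leb]_(x in `]a, b[) `|(EFin \o d) x| = 0)%E.
  rewrite -[RHS]i0; apply: eq_integral => x; rewrite inE/= in_itv/= => /d0 dx.
  by rewrite ger0_norm// ltW.
have mdo : measurable_fun `]a, b[%classic (EFin \o d) by case/integrableP : ido.
have [N [mN N0 subN]] := (ae_eq_integral_abs leb mo mdo).1 absE.
have : (leb `]a, b[%classic <= leb N)%E.
  apply: le_measure; rewrite ?inE// => x; rewrite /= in_itv/= => xab.
  by apply: subN => /=; rewrite in_itv/= => /(_ xab)[dx0]; move: (d0 _ xab); rewrite dx0 ltxx.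
rewrite N0 lebesgue_measure_itv/= lte_fin ab -EFinD lee_fin leNgt subr_gt0.
by rewrite ab.
Qed.

Lemma locally_lipschitz_continuous (f : R -> R) :
  (forall T, exists C, forall a b, - T <= a -> a <= b -> b <= T ->
    `|f b - f a| <= C * (b - a)) -> continuous f.
Proof.
move=> lipf x; have [C hC] := lipf (`|x| + 1).
apply/cvgrPdist_lt => e e0; near=> y.
have xy1 : `|x - y| < 1 by near: y; exists 1 => //=.
(* The constant [C] may be zero or negative; [|C| + 1] is a positive majorant that can be divided
   by. *)
have xye : `|x - y| < e / (`|C| + 1).
  near: y; exists (e / (`|C| + 1)) => //=; rewrite divr_gt0// ltr_wpDl.
have C0 : C <= `|C| + 1 by rewrite (le_trans (ler_norm _))// lerDl.
have C1 : 0 < `|C| + 1 by rewrite ltr_wpDl.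
have hx := ler_norm x; have hNx := ler_norm (- x); rewrite normrN in hNx.
suff : `|f x - f y| <= C * `|x - y|.
  move=> /le_lt_trans; apply; rewrite (le_lt_trans (ler_wpM2r _ C0))//.
  by rewrite mulrC -ltr_pdivlMr.
have [xy|yx] := leP x y.
  rewrite distrC (distrC x) (ger0_norm (_ : 0 <= y - x)); last lra.
  by move: xy1; rewrite ltr_distl => /andP[? ?]; apply: hC; lra.
rewrite (ger0_norm (_ : 0 <= x - y)); last lra.
by move: xy1; rewrite ltr_distl => /andP[? ?]; apply: hC; lra.
Unshelve. all: by end_near. Qed.

Lemma signed_integral_continuous d : lbm d -> continuous (K d).
Proof.
move=> hd; apply: locally_lipschitz_continuous => T; have [C hC] := hd.2 T.
exists C => a b Ta ab bT; rewrite signed_integralB//.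
rewrite (le_trans (le_normr_Rintegral _ (lbm_integrable a b hd)))//.
have -> : C * (b - a) = \int[leb]_(x in `]a, b]) (cst C x).
  rewrite Rintegral_cst//= lebesgue_measure_itv/= lte_fin.
  by move: ab; rewrite le_eqVlt => /predU1P[->|->//]; rewrite subrr ltxx.
apply: le_Rintegral => //.
- by apply/(@integrable_norm _ _ _ leb)/lbm_integrable.
- exact: lbm_integrable (lbm_cst C).
move=> x; rewrite /= in_itv/= => /andP[ax xb]; apply: hC.
by rewrite ler_norml; apply/andP; split; lra.
Qed.

End SignedIntegral.

(** * Existence of extreme minimizers of a coercive continuous function *)

Section Argmin.
Context {R : realType}.
Implicit Types (D : set R) (f : R -> R).

Definition argmin_on D f := [set s | D s /\ forall s', D s' -> f s <= f s'].

(* Coercivity is expressed by a window [A, B] outside which no point competes. *)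
Lemma argmin_on_extrema D f A B : closed D -> continuous f ->
  D `&` `[A, B] !=set0 ->
  (forall s, D s -> ~~ (A <= s <= B) ->
     exists2 c, (D `&` `[A, B]) c & f c < f s) ->
  [/\ argmin_on D f (sup (argmin_on D f)), argmin_on D f (inf (argmin_on D f)) &
      forall s, argmin_on D f s ->
        inf (argmin_on D f) <= s <= sup (argmin_on D f)].
Proof.
move=> cD cf DAB0 out.
have cDAB : compact (D `&` `[A, B]).
  by rewrite setIC; apply: compact_closedI => //; exact: segment_compact.
have [m mDAB minm] := compact_EVT_min DAB0 cDAB (continuous_subspaceT cf).
move: mDAB; rewrite inE => mDAB.
have minD s : D s -> f m <= f s.
  move=> Ds; have [sAB|sAB] := boolP (A <= s <= B).
    by apply: minm; rewrite inE; split => //=; rewrite in_itv.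
  have [c cDAB' /ltW] := out _ Ds sAB; apply: le_trans.
  by apply: minm; rewrite inE.
set S := argmin_on D f.
have Sm : S m by split => //; case: mDAB.
have SAB : S `<=` D `&` `[A, B].
  move=> s [Ds mins]; split => //=; rewrite in_itv/=.
  apply/negPn/negP => /(out _ Ds)[c [Dc _]].
  by rewrite ltNge mins.
(* The set of minimizers is a sublevel set inside the compact window, hence compact, so its supremum
   and infimum belong to it. *)
have SE : S = (D `&` `[A, B]) `&` f @^-1` [set y | y <= f m].
  apply/seteqP; split => [s Ss|s [[Ds _] /= fs]].
    by split; [exact: SAB|case: Ss => _; apply; case: Sm].
  by split => // s' /minD; exact: le_trans.
have cS : compact S.
  rewrite SE; apply: compact_closedI => //.
  by move/continuous_closedP : cf; apply; exact: closed_le.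
have S0 : S !=set0 by exists m.
have idc : {within S, continuous (@idfun R)} by apply: continuous_subspaceT => x; exact: cvg_id.
have [M SM maxM] := compact_EVT_max S0 cS idc.
have [l Sl minl] := compact_EVT_min S0 cS idc.
move: SM Sl; rewrite !inE => SM Sl.
have supE : sup S = M.
  apply/eqP; rewrite eq_le; apply/andP; split.
    by apply: ge_sup => // s Ss; apply: maxM; rewrite inE.
  by apply: ub_le_sup => //; exists M => s Ss; apply: maxM; rewrite inE.
have infE : inf S = l.
  apply/eqP; rewrite eq_le; apply/andP; split.
    by apply: ge_inf => //; exists l => s Ss; apply: minl; rewrite inE.
  by apply: lb_le_inf => // s Ss; apply: minl; rewrite inE.
rewrite supE infE; split => // s Ss.
by rewrite (minl s) ?(maxM s) ?inE.
Qed.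

End Argmin.

(** * Minimizers of [H - x P] and their dependence on [x] *)

Section Legendre.
Context {R : realType}.
Variables (P H : R -> R).

(** In the mass variable [p = P s] this is the minimization problem of the Legendre transform of [H]
    at slope [x]. *)
Definition minimizers (x : R) := argmin_on setT (fun s => H s - x * P s).
Definition max_label (x : R) := sup (minimizers x).
Definition min_label (x : R) := inf (minimizers x).
Local Notation smax := max_label.
Local Notation smin := min_label.

Hypothesis Pinc : forall a b, a < b -> P a < P b.
Hypotheses (cP : continuous P) (cH : continuous H).
Hypothesis minimizersP : forall x, 0 <= x ->
  [/\ minimizers x (smax x), minimizers x (smin x) &
      forall s, minimizers x s -> smin x <= s <= smax x].

Lemma minimizers_smax x : 0 <= x -> minimizers x (smax x).
Proof. by move=> /minimizersP[]. Qed.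

Lemma minimizers_smin x : 0 <= x -> minimizers x (smin x).
Proof. by move=> /minimizersP[]. Qed.

Lemma minimizers_ge x s : 0 <= x -> minimizers x s -> smin x <= s.
Proof. by move=> /minimizersP[_ _ h] /h/andP[]. Qed.

Lemma minimizers_le x s : 0 <= x -> minimizers x s -> s <= smax x.
Proof. by move=> /minimizersP[_ _ h] /h/andP[]. Qed.

Lemma smin_le_smax x : 0 <= x -> smin x <= smax x.
Proof. by move=> x0; apply: minimizers_le => //; exact: minimizers_smin. Qed.

(** Each of the two minimizers is tested against the other; this is the source of the bounds on [dH]
    by [dP]. *)
Lemma minimizers_slope x z s s' : minimizers x s -> minimizers z s' ->
  x * (P s' - P s) <= H s' - H s <= z * (P s' - P s).
Proof.
move=> [_ /(_ s' I) h1] [_ /(_ s I) h2].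
by apply/andP; split; rewrite -subr_ge0; nra.
Qed.

(** The slope bounds give [(z - x) (P s' - P s) >= 0], and [P] is strictly increasing. The order
    holds for any choice of minimizers, not only for the extreme ones. *)
Lemma minimizers_mono x z s s' : x < z -> minimizers x s -> minimizers z s' ->
  s <= s'.
Proof.
move=> xz Ss Ss'; have /andP[h1 h2] := minimizers_slope Ss Ss'.
rewrite leNgt; apply/negP => /Pinc; nra.
Qed.

Lemma smax_mono x z : 0 <= x -> x <= z -> smax x <= smax z.
Proof.
move=> x0; rewrite [x <= z]le_eqVlt => /predU1P[<-//|xz].
apply: (minimizers_mono xz); apply: minimizers_smax => //.
exact: le_trans (ltW xz).
Qed.

Lemma smin_mono x z : 0 <= x -> x <= z -> smin x <= smin z.
Proof.
move=> x0; rewrite [x <= z]le_eqVlt => /predU1P[<-//|xz].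
apply: (minimizers_mono xz); apply: minimizers_smin => //.
exact: le_trans (ltW xz).
Qed.

(** The graph of the argmin is closed: the minimality inequality passes to a joint limit of point
    and minimizer. *)
Lemma minimizers_lim (F : set_system R) (f : R -> R) (x l : R) : ProperFilter F ->
  z @[z --> F] --> x -> f z @[z --> F] --> l ->
  (\forall z \near F, minimizers z (f z)) -> minimizers x l.
Proof.
move=> PF Fx fl Ff; split => // s' _.
have HF : H (f z) @[z --> F] --> H l by exact: (continuous_cvg _ (@cH l) fl).
have PFl : P (f z) @[z --> F] --> P l by exact: (continuous_cvg _ (@cP l) fl).
have lhs : H (f z) - z * P (f z) @[z --> F] --> H l - x * P l.
  by apply: cvgB => //; exact: cvgM.
have rhs : H s' - z * P s' @[z --> F] --> H s' - x * P s'.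
  by apply: cvgB; [exact: cvg_cst|apply: cvgM => //; exact: cvg_cst].
apply: (ler_cvg_to lhs rhs).
by apply: filterS Ff => z [_ /(_ s' I)].
Qed.

(** Monotonicity provides a limit, at least [smax x]; being a limit of minimizers it is itself a
    minimizer at [x], hence at most [smax x]. *)
Lemma smax_cvg_right x : 0 <= x -> smax z @[z --> x^'+] --> smax x.
Proof.
move=> x0.
have lb : lbound [set smax z | z in `]x, +oo[] (smax x).
  move=> _ [z /= + <-]; rewrite in_itv/= andbT => xz.
  by apply: smax_mono => //; exact: ltW.
have cvgL : smax z @[z --> x^'+] --> inf [set smax z | z in `]x, +oo[].
  apply: nondecreasing_at_right_cvgr => //; last by exists (smax x).
  move=> a b; rewrite !in_itv/= !andbT => xa xb ab.
  by apply: smax_mono => //; rewrite (le_trans x0)// ltW.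
set L := inf _ in cvgL.
suff -> : smax x = L by [].
apply/eqP; rewrite eq_le; apply/andP; split.
  by apply: lb_le_inf => //; exists (smax (x + 1)), (x + 1) => //=; rewrite in_itv/= ltrDl ltr01.
apply: minimizers_le => //; apply: minimizers_lim cvgL _.
  exact: cvg_within.
near=> z; apply: minimizers_smax; by rewrite (le_trans x0)// ltW.
Unshelve. all: by end_near. Qed.

(** Minimizers at smaller points stay below [smin x], and their limit is a minimizer at [x]. Hence
    [smin x < smax x] says exactly that [smax] jumps at [x]. *)
Lemma smax_cvg_left x : 0 < x -> smax z @[z --> x^'-] --> smin x.
Proof.
move=> x0.
have ub z : 0 <= z -> z < x -> smax z <= smin x.
  move=> z0 zx; apply: (minimizers_mono zx); first exact: minimizers_smax.
  exact/minimizers_smin/ltW.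
have nz : \forall z \near x^'-, 0 < z < x.
  by near=> z; apply/andP; split; near: z; [exact: nbhs_left_gt|exact: nbhs_left_lt].
have : cvg (smax z @[z --> x^'-]).
  apply: nondecreasing_at_left_is_cvgr.
    near=> y => a b; rewrite !in_itv/= => /andP[ya ax] /andP[yb bx] ab.
    apply: smax_mono => //; rewrite (le_trans _ (ltW ya))//.
    by near: y; exact: nbhs_left_ge.
  near=> y; exists (smin x) => _ [z /= + <-]; rewrite in_itv/= => /andP[yz zx].
  apply: ub => //; rewrite (le_trans _ (ltW yz))//.
  by near: y; exact: nbhs_left_ge.
move=> /cvg_ex[L cvgL].
suff -> : smin x = L by [].
apply/eqP; rewrite eq_le; apply/andP; split.
  apply: minimizers_ge (ltW x0) _; apply: minimizers_lim cvgL _.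
    exact: cvg_within.
  by apply: filterS nz => z /andP[z0 _]; exact/minimizers_smax/ltW.
apply: (cvgr_to_le cvgL).
by apply: filterS nz => z /andP[z0 zx]; apply: ub => //; exact: ltW.
Unshelve. all: by end_near. Qed.

(** If [smax x < T], the competitor [T + 1] gains at least [x (P (T + 1) - P T)] and costs at most
    [H (T + 1) - H s0], where [s0] minimizes [H]; this bounds [x]. *)
Lemma smax_unbounded (T : R) : \forall x \near +oo, T <= smax x.
Proof.
pose s0 := smax 0.
have H0 s : H s0 <= H s.
  by have [_ /(_ s I)] := minimizers_smax (lexx 0); rewrite !mul0r !subr0.
have PT : 0 < P (T + 1) - P T by rewrite subr_gt0; apply: Pinc; rewrite ltrDl.
near=> x; rewrite leNgt; apply/negP => xT.
have x0 : 0 <= x by near: x; exact: nbhs_pinfty_ge.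
have : (H (T + 1) - H s0) / (P (T + 1) - P T) < x.
  by near: x; apply: nbhs_pinfty_gt; exact: num_real.
have [_ /(_ (T + 1) I) hx] := minimizers_smax x0.
have := Pinc xT; have := H0 (smax x).
rewrite ltr_pdivrMr//; nra.
Unshelve. all: by end_near. Qed.

End Legendre.

(** * The momentum integral as a limit of step functions *)

Section Momentum.
Context {R : realType}.
Variables (P Q H th sg : R -> R) (M : R).

Local Notation S := (minimizers P H).
Local Notation smax := (max_label P H).
Local Notation smin := (min_label P H).

(** The cases defining [u] collapse to two: at a jump, the mean velocity of the labels that have
    merged; elsewhere, the velocity of a free particle covering [x - sg] in time [th]. *)
Definition velocity x :=
  if smin x < smax x then (Q (smax x) - Q (smin x)) / (P (smax x) - P (smin x))
  else (x - sg (smax x)) / th (smax x).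

Definition cell_velocity a b :=
  (Q (smax b) - Q (smax a)) / (P (smax b) - P (smax a)).

Definition node (n k : nat) : R := k%:R / n.+1%:R.

(** The [(n+1)^2] cells of width [1/(n+1)] cover []0, n+1]], so the mesh is refined while the window
    grows. *)
Definition step_velocity n x := \sum_(k < n.+1 ^ 2)
  cell_velocity (node n k) (node n k.+1) *
  \1_(`]node n k, node n k.+1]%classic : set R) x.

Hypothesis Pinc : forall a b, a < b -> P a < P b.
Hypotheses (cP : continuous P) (cQ : continuous Q) (cH : continuous H).
Hypotheses (cth : continuous th) (csg : continuous sg).
Hypothesis minimizersP : forall x, 0 <= x ->
  [/\ S x (smax x), S x (smin x) & forall s, S x s -> smin x <= s <= smax x].
Hypothesis th_gt0 : forall x, 0 < x -> 0 < th (smax x).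
Hypothesis QP : forall a b, a <= b -> `|Q b - Q a| <= M * (P b - P a).
Hypothesis HQ : forall a b, a <= b ->
  `|H b - H a - th b * (Q b - Q a) - sg b * (P b - P a)|
    <= (b - a) * (M + 1) * (P b - P a).

Lemma P_mono a b : a <= b -> P a <= P b.
Proof. by rewrite [a <= b]le_eqVlt => /predU1P[->//|/Pinc/ltW]. Qed.

Lemma M_ge0 : 0 <= M.
Proof.
have := QP (@ler01 R); have := Pinc (@ltr01 R) => h1 h2.
by have := le_trans (normr_ge0 _) h2; rewrite pmulr_lge0// subr_gt0.
Qed.

(** The cell containing [x] may end at [x], so the sequence must be allowed to touch [x], unlike in
    the punctured right limit. *)
Lemma smax_seq_right x (b : nat -> R) : 0 <= x -> (forall n, x <= b n) ->
  b n @[n --> \oo] --> x -> smax (b n) @[n --> \oo] --> smax x.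
Proof.
move=> x0 xb bx; apply/cvgrPdist_lt => e e0.
have /cvgrPdist_lt/(_ e e0)[d /= d0 hd] := smax_cvg_right Pinc cP cH minimizersP x0.
near=> n; have := xb n; rewrite [x <= _]le_eqVlt => /predU1P[<-|xbn].
  by rewrite subrr normr0.
apply: hd => //=; near: n; move/cvgrPdist_lt : bx; exact.
Unshelve. all: by end_near. Qed.

Lemma smax_seq_left x (a : nat -> R) : 0 < x -> (forall n, a n < x) ->
  a n @[n --> \oo] --> x -> smax (a n) @[n --> \oo] --> smin x.
Proof.
move=> x0 ax bx; apply/cvgrPdist_lt => e e0.
have /cvgrPdist_lt/(_ e e0)[d /= d0 hd] := smax_cvg_left Pinc cP cH minimizersP x0.
near=> n; apply: hd => //=; near: n; move/cvgrPdist_lt : bx; exact.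
Unshelve. all: by end_near. Qed.

(* At a jump of [smax] the difference quotient converges by continuity;
   elsewhere [HQ] and the optimality of the minimizers pin it down. *)
Lemma cell_velocity_cvg x (a b : nat -> R) : 0 < x ->
  (forall n, 0 <= a n < x) -> (forall n, x <= b n) ->
  a n @[n --> \oo] --> x -> b n @[n --> \oo] --> x ->
  (forall n, P (smax (a n)) < P (smax (b n))) ->
  cell_velocity (a n) (b n) @[n --> \oo] --> velocity x.
Proof.
move=> x0 ax xb cva cvb Pab.
have a0 n : 0 <= a n by have /andP[] := ax n.
have b0 n : 0 < b n by exact: lt_le_trans (xb n).
have sa : smax (a n) @[n --> \oo] --> smin x.
  by apply: smax_seq_left => // n; have /andP[] := ax n.
have sb : smax (b n) @[n --> \oo] --> smax x by apply: smax_seq_right => //; exact: ltW.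
have comp (f : R -> R) (u : nat -> R) l : continuous f -> u n @[n --> \oo] --> l ->
    f (u n) @[n --> \oo] --> f l.
  by move=> cf ul; exact: (continuous_cvg _ (cf l) ul).
rewrite /velocity /cell_velocity; case: ifPn => [jump|].
  apply: cvgM; first by apply: cvgB; exact: comp.
  apply: cvgV; first by rewrite gt_eqF// subr_gt0 Pinc.
  by apply: cvgB; exact: comp.
rewrite -leNgt => nojump.
have sE : smin x = smax x.
  apply/eqP; rewrite eq_le nojump andbT.
  by apply: (smin_le_smax minimizersP); exact: ltW.
rewrite sE in sa.
set c := fun n => (Q (smax (b n)) - Q (smax (a n))) / (P (smax (b n)) - P (smax (a n))).
(* [e n] is the defect in [th v + sg = x] on the cell. Multiplied by the mass of the cell it is a
   difference of two errors: one bounded through optimality by [b n - a n], the other through [HQ]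
   by the increment of [smax]. Their sum is [bd n], which vanishes in the limit because [smax] does
   not jump at [x]. *)
pose e n := th (smax (b n)) * c n - (b n - sg (smax (b n))).
pose bd n := (b n - a n) + (smax (b n) - smax (a n)) * (M + 1).
have bd0 : bd n @[n --> \oo] --> 0.
  rewrite -[0]addr0 -[X in _ --> X + _](subrr x) -[X in _ --> _ + X](mul0r (M + 1)).
  apply: cvgD; first exact: cvgB.
  by apply: cvgM; [rewrite -[0](subrr (smax x)); exact: cvgB|exact: cvg_cst].
have ebd n : - bd n <= e n <= bd n.
  rewrite -ler_norml.
  have sab : smax (a n) <= smax (b n).
    apply: (smax_mono Pinc minimizersP) => //.
    by apply: le_trans (xb n); apply: ltW; have /andP[] := ax n.
  have dP : 0 < P (smax (b n)) - P (smax (a n)) by rewrite subr_gt0.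
  rewrite -(ler_pM2r dP) -[X in _ * X <= _](gtr0_norm dP) -normrM.
  have -> : e n * (P (smax (b n)) - P (smax (a n))) =
      (H (smax (b n)) - H (smax (a n)) - b n * (P (smax (b n)) - P (smax (a n)))) -
      (H (smax (b n)) - H (smax (a n)) - th (smax (b n)) * (Q (smax (b n)) - Q (smax (a n)))
       - sg (smax (b n)) * (P (smax (b n)) - P (smax (a n)))).
    by rewrite /e /c; field; rewrite gt_eqF.
  rewrite (le_trans (ler_normB _ _))// /bd mulrDl lerD ?HQ//.
  have /andP[h1 h2] := minimizers_slope (minimizers_smax minimizersP (a0 n))
    (minimizers_smax minimizersP (ltW (b0 n))).
  by rewrite ler_norml; apply/andP; split; nra.
have e0 : e n @[n --> \oo] --> 0.
  apply: (@squeeze_cvgr _ _ _ _ (fun n => - bd n) bd) => //; last by rewrite -oppr0; exact: cvgN.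
  exact: nearW.
have -> : c = fun n => (e n + (b n - sg (smax (b n)))) / th (smax (b n)).
  apply/funext => n; rewrite /e subrK mulrC mulKf// gt_eqF//; exact: th_gt0.
rewrite -[x - _]add0r; apply: cvgM.
  by apply: cvgD => //; apply: cvgB => //; exact: comp.
apply: cvgV; first by rewrite gt_eqF// th_gt0.
exact: comp.
Unshelve. all: by end_near. Qed.

Lemma cell_velocity_bound a b : 0 <= a -> a <= b -> `|cell_velocity a b| <= M.
Proof.
move=> a0 ab; have sab := smax_mono Pinc minimizersP a0 ab.
rewrite /cell_velocity normrM; have := P_mono sab.
rewrite [P _ <= P _]le_eqVlt => /predU1P[->|dP].
  by rewrite subrr invr0 normr0 mulr0 M_ge0.
rewrite normfV (gtr0_norm (_ : 0 < P (smax b) - P (smax a))) ?subr_gt0//.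
by rewrite ler_pdivrMr ?subr_gt0// QP.
Qed.

(** On a cell without mass the quotient is [0] by convention, but there [QP] forces the momentum
    increment to vanish as well. *)
Lemma cell_velocityM a b : 0 <= a -> a <= b ->
  cell_velocity a b * (P (smax b) - P (smax a)) = Q (smax b) - Q (smax a).
Proof.
move=> a0 ab; have sab := smax_mono Pinc minimizersP a0 ab.
rewrite /cell_velocity; have := P_mono sab.
rewrite [P _ <= P _]le_eqVlt => /predU1P[PE|dP]; last first.
  by rewrite divfK// gt_eqF// subr_gt0.
have := QP sab; rewrite PE !subrr mulr0 normr_le0 => /eqP ->.
by rewrite mulr0.
Qed.

Lemma node_ge0 n k : 0 <= node n k. Proof. exact: divr_ge0. Qed.

Lemma node_mono n k l : (k <= l)%N -> node n k <= node n l.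
Proof. by move=> kl; rewrite /node ler_pM2r ?invr_gt0// ler_nat. Qed.

Lemma cell_exists n x : 0 < x -> exists k, node n k < x <= node n k.+1.
Proof.
move=> x0.
have ex : exists k : nat, x <= node n k.
  exists (Num.bound (x * n.+1%:R)); rewrite ler_pdivlMr//.
  by apply/ltW/archi_boundP; rewrite mulr_ge0// ltW.
have [[|k] xk mink] := ex_minnP ex.
  by move: xk; rewrite /node mul0r leNgt x0.
exists k; rewrite xk andbT ltNge; apply/negP => /mink.
by rewrite ltnn.
Qed.

Lemma step_velocityE n k x : (k < n.+1 ^ 2)%N -> node n k < x <= node n k.+1 ->
  step_velocity n x = cell_velocity (node n k) (node n k.+1).
Proof.
move=> kn /andP[kx xk]; rewrite /step_velocity (bigD1 (Ordinal kn))//= big1 ?addr0.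
  by rewrite indicE mem_set ?mulr1//= in_itv/= kx.
move=> i /eqP ik; rewrite indicE memNset ?mulr0//= in_itv/= => /andP[ix xi].
apply: ik; apply: val_inj => /=; apply/eqP; rewrite eqn_leq; apply/andP; split.
  by rewrite leqNgt; apply/negP => /(@node_mono n); rewrite leNgt (lt_le_trans ix).
by rewrite leqNgt; apply/negP => /(@node_mono n); rewrite leNgt (lt_le_trans kx).
Qed.

Lemma step_velocity_bound n x : 0 < x -> `|step_velocity n x| <= M.
Proof.
move=> x0; have [k kx] := cell_exists n x0.
have [kn|kn] := ltnP k (n.+1 ^ 2).
  by rewrite (step_velocityE kn kx) cell_velocity_bound ?node_ge0 ?node_mono.
rewrite /step_velocity big1 ?normr0 ?M_ge0// => i _.
rewrite indicE memNset ?mulr0//= in_itv/= => /andP[_ xi].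
move: kx => /andP[/lt_le_trans/(_ xi) + _]; apply/negP; rewrite -leNgt node_mono//.
exact: leq_trans kn.
Qed.

Variable mu : {measure set (measurableTypeR R) -> \bar R}.
Hypothesis muE : forall a b, 0 <= a -> a <= b ->
  mu `]a, b]%classic = (P (smax b) - P (smax a))%:E.

Lemma integral_step_velocity n :
  (\int[mu]_(x in `]0%R, +oo[) (step_velocity n x)%:E =
   (Q (smax n.+1%:R) - Q (smax 0))%:E)%E.
Proof.
have mcell k : measurable (`]node n k, node n k.+1]%classic : set (measurableTypeR R)).
  exact: measurable_itv.
have icell k : mu.-integrable (`]0%R, +oo[ : set (measurableTypeR R))
    (fun x => (\1_(`]node n k, node n k.+1]%classic : set (measurableTypeR R)) x)%:E).
  apply/integrableP; split; first exact/measurable_EFinP/measurable_indic.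
  under eq_integral => x _ do rewrite gee0_abs ?lee_fin//.
  rewrite integral_indic//.
  rewrite (@le_lt_trans _ _ (mu `]node n k, node n k.+1]%classic))//.
    by apply: le_measure; rewrite ?inE//; exact: measurableI.
  by rewrite muE ?node_ge0 ?node_mono// ltry.
rewrite /step_velocity.
under eq_integral => x _ do rewrite -sumEFin.
rewrite integral_sum//=; last first.
  by move=> k; exact: (integrableZl _ _ (icell k)).
(* The last node is [(n+1)^2 / (n+1)], so the cell contributions telescope between [0] and [n+1]. *)
have -> : (n.+1%:R : R) = node n (n.+1 ^ 2) by rewrite /node natrX expr2 mulfK.
have -> : smax 0 = smax (node n 0) by rewrite /node mul0r.
rewrite -(telescope_sumr (fun k => Q (smax (node n k)))) // big_mkord -sumEFin.
apply: eq_bigr => k _.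
have mD : measurable (`]0%R, +oo[%classic : set (measurableTypeR R)).
  exact: measurable_itv.
rewrite [LHS](integralZl mD (icell k)) integral_indic//.
rewrite (_ : _ `&` _ = `]node n k, node n k.+1]%classic); last first.
  apply/setIidPl => x /=; rewrite !in_itv/= andbT => /andP[kx _].
  by apply: le_lt_trans kx; exact: node_ge0.
by rewrite muE ?node_ge0 ?node_mono// -EFinM cell_velocityM ?node_ge0 ?node_mono.
Qed.

Lemma measurable_velocity :
  measurable_fun (`]0%R, +oo[ : set (measurableTypeR R)) velocity.
Proof.
(* Monotonicity in [x] is known for nonnegative arguments only; clamping gives functions monotone,
   hence measurable, on the whole line. *)
pose p (x : R) := smax (Num.max x 0); pose m (x : R) := smin (Num.max x 0).
have max0 (x : R) : 0 <= Num.max x 0 by rewrite le_max lexx orbT.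
have mp : measurable_fun setT p.
  apply: nondecreasing_measurable => // x z xz; apply: (smax_mono Pinc minimizersP) => //.
  by rewrite ge_max !le_max xz lexx orbT.
have mm : measurable_fun setT m.
  apply: nondecreasing_measurable => // x z xz; apply: (smin_mono Pinc minimizersP) => //.
  by rewrite ge_max !le_max xz lexx orbT.
have comp (f g : R -> R) : continuous f -> measurable_fun setT g ->
    measurable_fun setT (f \o g).
  by move=> /continuous_measurable_fun mf mg; exact: measurableT_comp.
(* The power [-1] is measurable and agrees with the inverse on the nonnegative denominators that
   occur here. *)
pose w (x : R) := if m x < p x
  then (Q (p x) - Q (m x)) * (P (p x) - P (m x)) `^ (-1)
  else (x - sg (p x)) * (th (p x)) `^ (-1).
have mw : measurable_fun [set: R] w.
  apply: measurable_fun_ifT; first exact: measurable_fun_ltr.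
    apply: measurable_funM; first by apply: measurable_funB; exact: comp.
    apply: (measurableT_comp (@measurable_powR R (-1))).
    by apply: measurable_funB; exact: comp.
  apply: measurable_funM; first by apply: measurable_funB => //; exact: comp.
  by apply: (measurableT_comp (@measurable_powR R (-1))); exact: comp.
apply: (@eq_measurable_fun _ _ _ _ _ w); last exact: measurable_funTS.
move=> x; rewrite inE/= in_itv/= andbT => x0.
have xE : Num.max x 0 = x by apply/max_idPl/ltW.
rewrite /w /velocity /p /m xE; case: ifPn => [mp_lt|_].
  by rewrite powR_inv1// subr_ge0 P_mono// ltW.
by rewrite powR_inv1// ltW// th_gt0.
Qed.

Lemma mu_gt0_itv (Pinf : R) : P (smax n.+1%:R) @[n --> \oo] --> Pinf ->
  mu `]0%R, +oo[%classic = (Pinf - P (smax 0))%:E.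
Proof.
move=> cvP.
have -> : `]0%R, +oo[%classic = \bigcup_n (`]0%R, n.+1%:R]%classic : set (measurableTypeR R)).
  apply/seteqP; split => [x|x [n _]] /=; rewrite !in_itv/= ?andbT; last by case/andP.
  move=> x0; exists (Num.bound x) => //=; rewrite in_itv/= x0/=.
  by rewrite ltW// (lt_trans (archi_boundP (ltW x0)))// ltr_nat.
have c1 : (mu \o (fun n => `]0%R, n.+1%:R]%classic)) n @[n --> \oo] -->
    mu (\bigcup_n (`]0%R, n.+1%:R]%classic : set (measurableTypeR R))).
  apply: nondecreasing_cvg_mu.
  - by move=> n; exact: measurable_itv.
  - by apply: bigcup_measurable => n _; exact: measurable_itv.
  - move=> n k nk; apply/subsetPset/subset_itvl.
    by rewrite bnd_simp ler_nat ltnS.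
have c2 : (mu \o (fun n => `]0%R, n.+1%:R]%classic)) n @[n --> \oo] -->
    (Pinf - P (smax 0))%:E.
  have -> : mu \o (fun n => `]0%R, n.+1%:R]%classic) =
      (fun n => (P (smax n.+1%:R) - P (smax 0))%:E).
    by apply/funext => n /=; rewrite muE.
  apply: cvg_EFin; first exact: nearW.
  by apply: cvgB => //; exact: cvg_cst.
exact: cvg_unique c1 c2.
Qed.

(* Cells of measure zero, on which [step_velocity] carries no information, are
   countably many. *)
Lemma step_velocity_cvg : {ae mu, forall x : measurableTypeR R, `]0%R, +oo[%classic x ->
  (step_velocity n x)%:E @[n --> \oo] --> (velocity x)%:E}.
Proof.
pose N n k := if P (smax (node n k)) == P (smax (node n k.+1))
  then (`]node n k, node n k.+1]%classic : set (measurableTypeR R)) else set0.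
have negN : mu.-negligible (\bigcup_n \bigcup_k N n k).
  apply: negligible_bigcup => n; apply: negligible_bigcup => k; rewrite /N.
  case: ifPn => [/eqP PE|_]; last exact: negligible_set0.
  apply/negligibleP; first exact: measurable_itv.
  by rewrite /= muE ?node_ge0 ?node_mono// PE subrr.
apply: negligibleS negN => x /=; apply: contra_notP => xN; rewrite in_itv/= andbT => x0.
have /choice[k kx] : forall n, exists k, node n k < x <= node n k.+1.
  by move=> n; exact: cell_exists.
have kx1 n : node n (k n) < x by have /andP[] := kx n.
have kx2 n : x <= node n (k n).+1 by have /andP[] := kx n.
have h0 : (n.+1%:R^-1 : R) @[n --> \oo] --> 0 by exact: cvg_harmonic.
have nodeS n : node n (k n).+1 = node n (k n) + n.+1%:R^-1.
  by rewrite /node -natr1 mulrDl mul1r.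
have cva : node n (k n) @[n --> \oo] --> x.
  apply: (@squeeze_cvgr _ _ _ _ (fun n => x - n.+1%:R^-1) (cst x)).
  - apply: nearW => n; rewrite /= (ltW (kx1 n)) andbT lerBlDr.
    by rewrite -nodeS.
  - by rewrite -[X in _ --> X]subr0; apply: cvgB => //; exact: cvg_cst.
  - exact: cvg_cst.
have cvb : node n (k n).+1 @[n --> \oo] --> x.
  apply: (@squeeze_cvgr _ _ _ _ (cst x) (fun n => x + n.+1%:R^-1)).
  - by apply: nearW => n; rewrite /= kx2/= nodeS lerD2r ltW.
  - exact: cvg_cst.
  - by rewrite -[X in _ --> X]addr0; apply: cvgD => //; exact: cvg_cst.
apply: cvg_EFin; first exact: nearW.
have := @cell_velocity_cvg x (fun n => node n (k n)) (fun n => node n (k n).+1) x0.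
move=> /(_ _ kx2 cva cvb) h.
apply: cvg_trans (h _ _); last 2 first.
- by move=> n; rewrite node_ge0 kx1.
- move=> n; rewrite lt_neqAle P_mono ?andbT; last first.
    by apply: (smax_mono Pinc minimizersP); rewrite ?node_ge0 ?node_mono.
  apply/eqP => PE; apply: xN; exists n => //; exists (k n) => //.
  by rewrite /N PE eqxx /= in_itv/= kx1 kx2.
apply: near_eq_cvg; near=> n; apply/esym/step_velocityE; last exact: kx.
(* Once [n >= x], the cell index satisfies [k n < n (n+1)], so the cell lies among those summed in
   [step_velocity]. *)
have xn : x <= n%:R by near: n; exact: nbhs_infty_ger.
have := lt_le_trans (kx1 n) xn; rewrite /node ltr_pdivrMr// -natrM ltr_nat.
by move/leq_trans; apply; rewrite expnS expn1 leq_mul2r leqnSn orbT.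
Unshelve. all: by end_near. Qed.

Lemma integral_velocity (Pinf Qinf : R) :
  P (smax n.+1%:R) @[n --> \oo] --> Pinf ->
  Q (smax n.+1%:R) @[n --> \oo] --> Qinf ->
  (\int[mu]_(x in `]0%R, +oo[) (velocity x)%:E = (Qinf - Q (smax 0))%:E)%E.
Proof.
move=> cvP cvQ.
have mD : measurable (`]0%R, +oo[%classic : set (measurableTypeR R)).
  exact: measurable_itv.
have mstep n : measurable_fun (`]0%R, +oo[ : set (measurableTypeR R)) (step_velocity n).
  by apply: measurable_sum => i; exact: measurable_funM.
(* The dominating constant is integrable because the limit [Pinf] makes the total mass finite. *)
have iM : mu.-integrable (`]0%R, +oo[ : set (measurableTypeR R)) (cst M%:E).
  apply/integrableP; split; first exact: measurable_cst.
  by rewrite integral_cst// (mu_gt0_itv cvP) -EFinM ltry.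
have bstep : {ae mu, forall (x : measurableTypeR R) n, `]0%R, +oo[%classic x ->
    (`|(step_velocity n x)%:E| <= cst M%:E x)%E}.
  apply: aeW => x n; rewrite /= in_itv/= andbT => x0.
  by rewrite lee_fin step_velocity_bound.
have [_ _] := dominated_convergence mD
  (fun n => (measurable_EFinP _ _).2 (mstep n))
  ((measurable_EFinP _ _).2 measurable_velocity) step_velocity_cvg iM bstep.
have -> : [sequence (\int[mu]_(x in `]0%R, +oo[) (EFin \o step_velocity n) x)%E]_n =
    (fun n => (Q (smax n.+1%:R) - Q (smax 0))%:E).
  by apply/funext => n /=; exact: integral_step_velocity.
move=> cv; apply/esym; move: cv; apply: cvg_unique => //.
apply: cvg_EFin; first exact: nearW.
by apply: cvgB => //; exact: cvg_cst.
Qed.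

End Momentum.

(** * Mass, momentum and action along the labels *)

Section Label.
Context {R : realType}.
Variables (r v : R -> R) (t M : R).
Local Notation lbm := locally_bounded_measurable.
Local Notation K := signed_integral.

(** The time available before [t]: all of [t] for an initial label, [t - tau] for the boundary label
    [s = - tau]. It is negative for particles entering after [t]. *)
Definition free_time (s : R) := Num.min t (t + s).
Definition start (s : R) := Num.max s 0.
Definition labelP := K r.
Definition labelQ := K (fun s => v s * r s).
(** The density is the position at time [t] of the freely moving particle, weighted by its mass. *)
Definition labelH := K (fun s => (free_time s * v s + start s) * r s).

Hypotheses (lr : lbm r) (lv : lbm v) (r0 : forall s, 0 < r s).
Hypotheses (vM : forall s : R, `|v s| <= M) (v0 : forall s : R, s < 0 -> 0 < v s).
Hypothesis t0 : (0 : R) < t.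

Lemma lbm_free_time : lbm free_time.
Proof.
by apply: lbm_min; [exact: lbm_cst|exact: lbm_add (lbm_cst _) (@lbm_id R)].
Qed.

Lemma lbm_start : lbm start.
Proof. by apply: lbm_max; [exact: lbm_id|exact: lbm_cst]. Qed.

Lemma lbm_momentum : lbm (fun s => v s * r s).
Proof. exact: lbm_mul. Qed.

Lemma lbm_action : lbm (fun s => (free_time s * v s + start s) * r s).
Proof.
apply: lbm_mul => //; apply: lbm_add; last exact: lbm_start.
by apply: lbm_mul => //; exact: lbm_free_time.
Qed.

Lemma free_time_lip a b : a <= b -> 0 <= free_time b - free_time a <= b - a.
Proof.
move=> ab; rewrite /free_time !minEle; case: ifPn; case: ifPn;
  rewrite -?ltNge => ? ?; by apply/andP; split; lra.
Qed.

Lemma start_lip a b : a <= b -> 0 <= start b - start a <= b - a.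
Proof.
move=> ab; rewrite /start !maxEle; case: ifPn; case: ifPn;
  rewrite -?ltNge => ? ?; by apply/andP; split; lra.
Qed.

Lemma free_time_continuous : continuous free_time.
Proof.
apply: locally_lipschitz_continuous => T; exists 1 => a b _ ab _.
by have /andP[h1 h2] := free_time_lip ab; rewrite mul1r ger0_norm.
Qed.

Lemma start_continuous : continuous start.
Proof.
apply: locally_lipschitz_continuous => T; exists 1 => a b _ ab _.
by have /andP[h1 h2] := start_lip ab; rewrite mul1r ger0_norm.
Qed.

Lemma labelP_continuous : continuous labelP.
Proof. exact: signed_integral_continuous. Qed.

Lemma labelQ_continuous : continuous labelQ.
Proof. exact/signed_integral_continuous/lbm_momentum. Qed.

Lemma labelH_continuous : continuous labelH.
Proof. exact/signed_integral_continuous/lbm_action. Qed.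

Lemma bound_ge0 : (0 : R) <= M.
Proof. exact: le_trans (normr_ge0 (v 0)) (vM 0). Qed.

Lemma labelP_inc a b : a < b -> labelP a < labelP b.
Proof. by move=> ab; apply: signed_integral_lt. Qed.

Lemma labelQ_le a b : a <= b ->
  `|labelQ b - labelQ a| <= M * (labelP b - labelP a).
Proof.
move=> ab; have lMr c : lbm (fun s => c * r s) by apply: lbm_mul => //; exact: lbm_cst.
have vb s : - M <= v s <= M by rewrite -ler_norml.
have up : labelQ b - labelQ a <= M * labelP b - M * labelP a.
  rewrite -!(signed_integralZ _ _ lr); apply: signed_integral_le => //.
    exact: lbm_momentum.
  by move=> s _; rewrite ler_pM2r//; have /andP[] := vb s.
have lo : - M * labelP b - - M * labelP a <= labelQ b - labelQ a.
  rewrite -!(signed_integralZ _ _ lr); apply: signed_integral_le => //.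
    exact: lbm_momentum.
  by move=> s _; rewrite ler_pM2r//; have /andP[] := vb s.
by rewrite ler_norml; apply/andP; split; lra.
Qed.

(** In [dH = free_time dQ + start dP] both coefficients are frozen at [b]. Each varies by at most
    [b - a] on the interval and velocities are at most [M], whence the factor [M + 1]. *)
Lemma labelH_le a b : a <= b ->
  `|labelH b - labelH a - free_time b * (labelQ b - labelQ a)
    - start b * (labelP b - labelP a)|
    <= (b - a) * (M + 1) * (labelP b - labelP a).
Proof.
move=> ab; set C := (b - a) * (M + 1).
pose d c s := free_time b * (v s * r s) + (start b + c) * r s.
have l1 : lbm (fun s => free_time b * (v s * r s)).
  by apply: lbm_mul; [exact: lbm_cst|exact: lbm_momentum].
have l2 c : lbm (fun s => (start b + c) * r s) by apply: lbm_mul => //; exact: lbm_cst.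
have ld c : lbm (d c) by exact: lbm_add.
have KE c s : K (d c) s = free_time b * labelQ s + (start b + c) * labelP s.
  by rewrite signed_integralD// !signed_integralZ//; exact: lbm_momentum.
have dens s : a < s <= b -> - C <=
    (free_time s - free_time b) * v s + (start s - start b) <= C.
  move=> /andP[as_ sb]; have := vM s; rewrite ler_norml => /andP[v1 v2].
  have M0 := bound_ge0.
  have /andP[f1 f1'] := free_time_lip sb; have /andP[f2 f2'] := start_lip sb.
  rewrite /C.
  by apply/andP; split; nra.
have up := @signed_integral_le _ _ _ a b lbm_action (ld C) ab.
have lo := @signed_integral_le _ _ _ a b (ld (- C)) lbm_action ab.
have {}up : labelH b - labelH a <= K (d C) b - K (d C) a.
  apply: up => s /dens/andP[_ h]; rewrite -subr_ge0 /d.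
  have -> : free_time b * (v s * r s) + (start b + C) * r s -
    (free_time s * v s + start s) * r s =
    (C - ((free_time s - free_time b) * v s + (start s - start b))) * r s by ring.
  by rewrite mulr_ge0 ?subr_ge0// ltW.
have {}lo : K (d (- C)) b - K (d (- C)) a <= labelH b - labelH a.
  apply: lo => s /dens/andP[h _]; rewrite -subr_ge0 /d.
  have -> : (free_time s * v s + start s) * r s -
    (free_time b * (v s * r s) + (start b + - C) * r s) =
    (((free_time s - free_time b) * v s + (start s - start b)) + C) * r s by ring.
  by apply: mulr_ge0; [rewrite -lerBlDr sub0r|exact: ltW].
rewrite !KE in up lo.
by rewrite ler_norml; apply/andP; split; lra.
Qed.

Definition action x s := labelH s - x * labelP s.

Lemma actionE x s :
  action x s = K (fun s => (free_time s * v s + start s - x) * r s) s.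
Proof.
have lxr : lbm (fun s => - x * r s) by apply: lbm_mul => //; exact: lbm_cst.
rewrite /action -mulNr -(signed_integralZ _ _ lr) -signed_integralD//; last exact: lbm_action.
by congr (K _ _); apply/funext => z; rewrite -mulrDl.
Qed.

Lemma lbm_actionx x : lbm (fun s => (free_time s * v s + start s - x) * r s).
Proof.
apply: lbm_mul => //; apply: lbm_add; last exact: lbm_cst.
apply: lbm_add; last exact: lbm_start.
by apply: lbm_mul => //; exact: lbm_free_time.
Qed.

Lemma action_continuous x : continuous (action x).
Proof.
have -> : action x = K (fun s => (free_time s * v s + start s - x) * r s).
  by apply/funext => s; exact: actionE.
exact/signed_integral_continuous/lbm_actionx.
Qed.

(** The density of the action is the free position minus [x], weighted by mass, so its sign tells on
    which side of [x] the free particle ends. *)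
Lemma action_incr (x a b : R) : a < b ->
  (forall s : R, a < s < b -> x < free_time s * v s + start s) ->
  action x a < action x b.
Proof.
move=> ab h; rewrite !actionE; apply: signed_integral_lt => //.
  exact: lbm_actionx.
by move=> s /h hs; rewrite mulr_gt0// subr_gt0.
Qed.

Lemma action_decr (x a b : R) : a < b ->
  (forall s : R, a < s < b -> free_time s * v s + start s < x) ->
  action x b < action x a.
Proof.
move=> ab h; rewrite -ltrN2 !actionE.
have KN s d : lbm d -> - K d s = K (fun z => -1 * d z) s.
  by move=> hd; rewrite signed_integralZ// mulN1r.
rewrite !KN; try exact: lbm_actionx.
apply: signed_integral_lt => //.
  by apply: lbm_mul; [exact: lbm_cst|exact: lbm_actionx].
by move=> s /h hs; rewrite mulN1r -mulNr mulr_gt0// oppr_gt0 subr_lt0.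
Qed.

(** Labels below [- t] have negative free time and positive velocity, so their formal position is
    negative and the action decreases up to [- t]. *)
Lemma action_left (x s : R) : (0 : R) <= x -> s < - t -> action x (- t) < action x s.
Proof.
move=> x0 st; have tp := t0; apply: action_decr => // z /andP[sz zt].
have v0z : 0 < v z by apply: v0; lra.
by rewrite /free_time /start min_r ?max_r; [nra|lra|lra].
Qed.

(** A particle starting beyond [x + t M] cannot come back to [x] within time [t]. *)
Lemma action_right (x s : R) : (0 : R) <= x -> x + t * M < s ->
  action x (x + t * M) < action x s.
Proof.
move=> x0 st; have tp := t0; apply: action_incr => // z /andP[sz zt].
have M0 := bound_ge0; have := vM z; rewrite ler_norml => /andP[v1 v2].
have z0 : 0 <= z by nra.
by rewrite /free_time /start min_l ?max_l; [nra|lra|lra].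
Qed.

(** The competitors [- t] and [x + t M] lie between [0] and the excluded label, hence in the
    interval [D]. This covers the whole line and both half-lines at once. *)
Lemma argmin_action (D : set R) (x : R) : 0 <= x -> closed D -> D 0 -> is_interval D ->
  [/\ argmin_on D (action x) (sup (argmin_on D (action x))),
      argmin_on D (action x) (inf (argmin_on D (action x))) &
      forall s, argmin_on D (action x) s ->
        inf (argmin_on D (action x)) <= s <= sup (argmin_on D (action x))].
Proof.
move=> x0 cD D0 iD; have tp := t0; have M0 := bound_ge0.
have Y0 : 0 <= x + t * M by rewrite addr_ge0// mulr_ge0// ltW.
apply: (@argmin_on_extrema _ _ _ (- t) (x + t * M)) => //.
- exact: action_continuous.
- by exists 0; split => //=; rewrite in_itv/= Y0 andbT; lra.
move=> s Ds; rewrite negb_and -!ltNge => /orP[st|st].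
  exists (- t); last exact: action_left.
  split; first by apply: (iD s 0) => //; apply/andP; split; lra.
  by rewrite /= in_itv/= lexx /=; lra.
exists (x + t * M); last exact: action_right.
split; first by apply: (iD 0 s) => //; apply/andP; split; lra.
by rewrite /= in_itv/= lexx andbT; lra.
Qed.

Local Notation smax := (max_label labelP labelH).
Local Notation smin := (min_label labelP labelH).
Local Notation S := (minimizers labelP labelH).

Lemma label_minimizersP (x : R) : 0 <= x ->
  [/\ S x (smax x), S x (smin x) & forall s, S x s -> smin x <= s <= smax x].
Proof. by move=> x0; exact: argmin_action. Qed.

Lemma minimizers_geN (x s : R) : 0 <= x -> S x s -> - t <= s.
Proof.
move=> x0 [_ /(_ (- t) I)]; rewrite !leNgt; apply: contra => st.
exact: action_left.
Qed.

(** Particles just above the label [- t] have no time to reach [x > 0], so the action still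
    decreases there. Dividing by the free time relies on this. *)
Lemma smax_gtN (x : R) : 0 < x -> - t < smax x.
Proof.
move=> x0; have [Sx _ _] := label_minimizersP (ltW x0).
rewrite lt_neqAle (minimizers_geN (ltW x0) Sx) andbT; apply/eqP => E.
have tp := t0; have M0 := bound_ge0.
(* [d <= t] keeps the labels nonpositive, and [d (M + 1) <= x] keeps the distance travelled, at most
   [d M], below [x]. *)
pose d := Num.min t (x / (M + 1)).
have d0 : 0 < d by rewrite lt_min t0 divr_gt0//; lra.
have dt : d <= t by rewrite ge_min lexx.
have dx : d * (M + 1) <= x by rewrite -ler_pdivlMr; [rewrite ge_min lexx orbT|lra].
have : action x (- t + d) < action x (- t).
  apply: action_decr => [|s /andP[s1 s2]]; first by rewrite ltrDl.
  have := vM s; rewrite ler_norml => /andP[v1 v2].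
  by rewrite /free_time /start min_r ?max_r; [nra|lra|lra].
by rewrite ltNge; case: Sx => _ /(_ (- t + d) I); rewrite -E => ->.
Qed.

Lemma free_time_smax (x : R) : 0 < x -> 0 < free_time (smax x).
Proof.
by move=> x0; rewrite /free_time lt_min t0/=; have := smax_gtN x0; have := t0; lra.
Qed.

(** For [x = 0] a boundary label has free position [(t + s) v s], whose sign changes exactly at
    [- t]. *)
Lemma action0_boundary (s : R) : s <= 0 -> s != - t -> action 0 (- t) < action 0 s.
Proof.
move=> s0; have tp := t0; rewrite neq_lt => /orP[|st]; first exact: action_left.
apply: action_incr => // z /andP[z1 z2].
have v0z : 0 < v z by apply: v0; lra.
rewrite /free_time /start min_r ?max_r; [|lra|lra].
by rewrite addr0 mulr_gt0//; lra.
Qed.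

End Label.

(** * Gluing initial and boundary data into one density *)

Section Gluing.
Context {R : realType}.
Implicit Types d f g : R -> R.
Local Notation leb := (@lebesgue_measure R).
Local Notation lbm := locally_bounded_measurable.
Local Notation K := signed_integral.

Definition reflect_glue f g s := if 0 <= s then f s else g (- s).

Lemma lbm_glue f g :
  measurable_fun (`[0%R, +oo[ : set R) f -> measurable_fun (`[0%R, +oo[ : set R) g ->
  (forall T, exists C, forall x, 0 <= x <= T -> `|f x| <= C) ->
  (forall T, exists C, forall x, 0 <= x <= T -> `|g x| <= C) ->
  lbm (reflect_glue f g).
Proof.
move=> mf mg bf bg; split.
  have m0 : measurable_fun [set: R] (fun s : R => 0 <= s) by exact: measurable_fun_ler.
  apply: measurable_fun_if => //.
  - apply: measurable_funS mf => //.
    by move=> s /= [_ s0]; rewrite in_itv/= s0.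
  - apply: (@measurable_comp _ _ _ R R R `[0%R, +oo[%classic g _ (-%R)) => //.
    move=> _ [s [_ /= s0] <-]; rewrite in_itv/= andbT oppr_ge0 ltW//.
    by rewrite ltNge s0.
move=> T; have [C hC] := bf T; have [C' hC'] := bg T.
exists (Num.max C C') => s sT; rewrite /reflect_glue; have [s0|s0] := leP 0 s; rewrite le_max.
  by rewrite hC// s0 (le_trans (ler_norm _)).
by rewrite hC' ?orbT// oppr_ge0 ltW//= -(ltr0_norm s0).
Qed.

Section Density.
Variables (d f g : R -> R).
Hypothesis ld : lbm d.
Hypothesis mg : measurable_fun (`[0%R, +oo[ : set R) g.
Hypotheses (df : forall s : R, 0 <= s -> d s = f s).
Hypothesis (dg : forall s : R, s < 0 -> d s = g (- s)).

Lemma integral_pos_label (a b : R) : 0 <= a ->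
  (\int[leb]_(x in `[a, b]) (f x)%:E = \int[leb]_(x in `]a, b]) (d x)%:E)%E.
Proof.
move=> a0; rewrite integral_itv_obnd_cbnd; last first.
  by apply/measurable_EFinP; apply: measurable_funTS; exact: ld.1.
apply: eq_integral => x; rewrite inE/= in_itv/= => /andP[ax _].
by rewrite df// (le_trans a0).
Qed.

(** End points are null sets and are dropped before reflecting: for [a = 0] the label [0] carries
    the value of [f], not that of [g]. *)
Lemma integral_neg_label (a b : R) : 0 <= a ->
  (\int[leb]_(x in `[a, b]) (g x)%:E = \int[leb]_(x in `](- b)%R, (- a)%R]) (d x)%:E)%E.
Proof.
move=> a0.
have mgo : measurable_fun (`]a, b[ : set R) (EFin \o g).
  apply/measurable_EFinP; apply: measurable_funS mg => //.
  by move=> x; rewrite /= !in_itv/= andbT => /andP[ax _]; rewrite (le_trans a0)// ltW.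
rewrite -integral_itv_bndo_bndc; last first.
  apply/measurable_EFinP; apply: measurable_funS mg => //.
  by move=> x; rewrite /= !in_itv/= andbT => /andP[ax _]; rewrite (le_trans a0).
rewrite -integral_itv_obnd_cbnd// (integral_reflect (measurable_itv _) mgo).
rewrite (_ : -%R @^-1` _ = `](- b), (- a)[%classic); last exact: opp_preimage_itvbndbnd.
rewrite -[RHS]integral_itv_bndo_bndc; last first.
  by apply/measurable_EFinP; apply: measurable_funTS; exact: ld.1.
apply: eq_integral => x; rewrite inE/= in_itv/= => /andP[_ xa].
by rewrite dg// (lt_le_trans xa)// oppr_le0.
Qed.

Lemma Rintegral_pos_label (a b : R) : 0 <= a -> a <= b ->
  \int[leb]_(x in `[a, b]) f x = K d b - K d a.
Proof. by move=> a0 ab; rewrite signed_integralB// /Rintegral integral_pos_label. Qed.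

Lemma Rintegral_neg_label (a b : R) : 0 <= a -> a <= b ->
  \int[leb]_(x in `[a, b]) g x = K d (- a) - K d (- b).
Proof.
by move=> a0 ab; rewrite signed_integralB ?lerN2// /Rintegral integral_neg_label.
Qed.

Lemma signed_integral0 : K d 0 = 0.
Proof. by rewrite /K lexx set_itvoc0 Rintegral_set0. Qed.

Lemma integral_neg_labelE (b : R) : 0 <= b ->
  (\int[leb]_(x in `[0%R, b]) (g x)%:E = (- K d (- b)%R)%:E)%E.
Proof.
move=> b0; rewrite integral_neg_label// oppr0.
have -> : - K d (- b) = \int[leb]_(x in `](- b), 0]) d x.
  by rewrite -signed_integralB ?oppr_le0// signed_integral0 sub0r.
have mD : measurable (`](- b), 0]%classic : set (measurableTypeR R)).
  exact: measurable_itv.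
by rewrite /Rintegral fineK//; exact: (integrable_fin_num mD (lbm_integrable _ _ ld)).
Qed.

(** Dominated convergence for the truncations of [f] to [[0, u n]], each point being eventually
    inside. *)
Lemma signed_integral_cvg (u : nat -> R) :
  leb.-integrable `[0%R, +oo[ (EFin \o f) ->
  (forall T, \forall n \near \oo, T <= u n) ->
  K d (u n) @[n --> \oo] --> \int[leb]_(x in `[0%R, +oo[) f x.
Proof.
move=> intf unb.
pose fn n := ((EFin \o f) \_ `[0%R, u n]%classic).
have mf : measurable_fun (`[0%R, +oo[ : set (measurableTypeR R)) (EFin \o f).
  by case/integrableP : intf.
have mD : measurable (`[0%R, +oo[%classic : set (measurableTypeR R)).
  exact: measurable_itv.
have mfn n : measurable_fun (`[0%R, +oo[ : set (measurableTypeR R)) (fn n).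
  have mE : measurable (`[0%R, u n]%classic : set (measurableTypeR R)).
    exact: measurable_itv.
  by apply/(measurable_restrict _ mE mD); apply: measurable_funS mf => //; exact: subIsetr.
have fnf : {ae leb, forall x : measurableTypeR R, `[0%R, +oo[%classic x ->
    fn n x @[n --> \oo] --> (EFin \o f) x}.
  apply: aeW => x; rewrite /= in_itv/= andbT => x0.
  apply: cvg_near_cst; near=> n; rewrite /fn patchE mem_set//= in_itv/= x0/=.
  by near: n.
have inf : leb.-integrable `[0%R, +oo[ (fun x => `|(EFin \o f) x|)%E by exact: integrable_abse.
have fnb : {ae leb, forall (x : measurableTypeR R) n, `[0%R, +oo[%classic x ->
    (`|fn n x| <= `|(EFin \o f) x|)%E}.
  by apply: aeW => x n _; rewrite /fn patchE; case: ifPn => // _; rewrite abse0.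
have [_ _ cv] := dominated_convergence mD mfn mf fnf inf fnb.
have fin : (\int[leb]_(x in `[0%R, +oo[) (EFin \o f) x)%E \is a fin_num.
  exact: integrable_fin_num.
have cvf : (fine (\int[leb]_(x in `[0%R, +oo[) fn n x)%E) @[n --> \oo] -->
    \int[leb]_(x in `[0%R, +oo[) f x.
  by apply: fine_cvg; rewrite fineK//; exact: cv.
apply: cvg_trans cvf; apply: near_eq_cvg; near=> n.
have un0 : 0 <= u n by near: n; exact: unb.
rewrite -integral_mkcondr setIidr; last first.
  by move=> x; rewrite /= !in_itv/= andbT => /andP[].
by have := Rintegral_pos_label (lexx 0) un0; rewrite signed_integral0 subr0.
Unshelve. all: by end_near. Qed.

End Density.
End Gluing.

(** * Minimizers over a union of two domains *)

Section ArgminSplit.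
Context {R : realType}.
Variables (f : R -> R) (D D' : set R).
Hypothesis DD' : D `|` D' = setT.

Lemma argmin_split_lt m m' : argmin_on D f m -> argmin_on D' f m' -> f m < f m' ->
  argmin_on setT f = argmin_on D f.
Proof.
move=> [Dm minm] [Dm' minm'] mm'; apply/seteqP; split => s [Ds mins].
  split; last by move=> s' _; exact: mins.
  have : (D `|` D') s by rewrite DD'.
  case=> // /minm'; rewrite leNgt; apply: contraNP => _.
  by rewrite (le_lt_trans _ mm')// mins.
split => // s' _; have : (D `|` D') s' by rewrite DD'.
case=> [/mins//|/minm']; apply: le_trans.
by rewrite ltW// (le_lt_trans _ mm')// mins.
Qed.

Lemma argmin_split_eq m m' : argmin_on D f m -> argmin_on D' f m' -> f m = f m' ->
  argmin_on setT f = argmin_on D f `|` argmin_on D' f.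
Proof.
move=> [Dm minm] [Dm' minm'] mm'; apply/seteqP; split => s.
  move=> [_ mins]; have : (D `|` D') s by rewrite DD'.
  by case=> Ds; [left|right]; split => // s' _; exact: mins.
case=> -[Ds mins]; split => // s' _; have : (D `|` D') s' by rewrite DD'.
- case=> [/mins//|/minm']; apply: le_trans.
  by rewrite -mm'; exact: mins.
- case=> [/minm|/mins//]; apply: le_trans.
  by rewrite mm'; exact: mins.
Qed.

End ArgminSplit.

(** * The data of the problem in terms of labels *)

Section Model.
Context {R : realType}.
Variables (u0 ub rho0 rhob : R -> R) (t M : R).
Hypotheses (mu0 : measurable_fun (`[0%R, +oo[ : set R) u0)
  (bu0 : forall x : R, 0 <= x -> `|u0 x| <= M)
  (mub : measurable_fun (`[0%R, +oo[ : set R) ub)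
  (bub : forall x : R, 0 <= x -> `|ub x| <= M)
  (pub : forall x : R, 0 <= x -> 0 < ub x)
  (prho0 : forall x : R, 0 <= x -> 0 < rho0 x)
  (prhob : forall x : R, 0 <= x -> 0 < rhob x)
  (lbrho0 : forall T : R, exists C : R, forall x, 0 <= x <= T -> `|rho0 x| <= C)
  (lbrhob : forall T : R, exists C : R, forall x, 0 <= x <= T -> `|rhob x| <= C)
  (mrho0 : measurable_fun (`[0%R, +oo[ : set R) rho0)
  (mrhob : measurable_fun (`[0%R, +oo[ : set R) rhob)
  (ht : (0 : R) < t).
Local Notation leb := (@lebesgue_measure R).
Local Notation lbm := locally_bounded_measurable.
Local Notation K := signed_integral.

(** Through the boundary, mass enters at the rate [rhob ub] per unit of time. *)
Definition mass_density := reflect_glue rho0 (fun s => rhob s * ub s).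
Definition label_velocity := reflect_glue u0 ub.
Local Notation r := mass_density.
Local Notation v := label_velocity.
Local Notation P := (labelP r).
Local Notation Q := (labelQ r v).
Local Notation H := (labelH r v t).
Local Notation act := (action r v t).
Local Notation S := (minimizers P H).
Local Notation smax := (max_label P H).
Local Notation smin := (min_label P H).

Lemma lbm_mass_density : lbm r.
Proof.
apply: lbm_glue => //; first exact: measurable_funM.
move=> T; have [C hC] := lbrhob T; exists (C * M) => x /andP[x0 xT].
by rewrite normrM ler_pM ?hC ?bub// x0.
Qed.

Lemma lbm_label_velocity : lbm v.
Proof. by apply: lbm_glue => // T; exists M => x /andP[x0 _]; auto. Qed.

Lemma mass_density_gt0 (s : R) : 0 < r s.
Proof.
rewrite /r /reflect_glue; have [s0|s0] := leP 0 s; first exact: prho0.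
by rewrite mulr_gt0 ?prhob ?pub// oppr_ge0 ltW.
Qed.

Lemma label_velocity_bound (s : R) : `|v s| <= M.
Proof.
rewrite /v /reflect_glue; have [s0|s0] := leP 0 s; first exact: bu0.
by rewrite bub// oppr_ge0 ltW.
Qed.

Lemma label_velocity_gt0 (s : R) : s < 0 -> 0 < v s.
Proof. by move=> s0; rewrite /v /reflect_glue leNgt s0/= pub// oppr_ge0 ltW. Qed.

Let lr := lbm_mass_density.
Let lv := lbm_label_velocity.
Let r0 := mass_density_gt0.
Let vM := label_velocity_bound.
Let v0 := label_velocity_gt0.

Lemma Rintegral_rho0 (a b : R) : 0 <= a -> a <= b -> \int[leb]_(x in `[a, b]) rho0 x = P b - P a.
Proof.
apply: (@Rintegral_pos_label _ _ _ lr) => s s0.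
by rewrite /r /reflect_glue s0.
Qed.

Let rN (s : R) : s < 0 -> r s = rhob (- s) * ub (- s).
Proof. by move=> s0; rewrite /r /reflect_glue leNgt s0. Qed.

Let vN (s : R) : s < 0 -> v s = ub (- s).
Proof. by move=> s0; rewrite /v /reflect_glue leNgt s0. Qed.

Let rP (s : R) : 0 <= s -> r s = rho0 s.
Proof. by move=> s0; rewrite /r /reflect_glue s0. Qed.

Let vP (s : R) : 0 <= s -> v s = u0 s.
Proof. by move=> s0; rewrite /v /reflect_glue s0. Qed.

Lemma Rintegral_rhob_ub (a b : R) : 0 <= a -> a <= b ->
  \int[leb]_(x in `[a, b]) (rhob x * ub x) = P (- a) - P (- b).
Proof. exact: (@Rintegral_neg_label _ r _ lr (measurable_funM mrhob mub) rN). Qed.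

Lemma Rintegral_rho0_u0 (a b : R) : 0 <= a -> a <= b ->
  \int[leb]_(x in `[a, b]) (rho0 x * u0 x) = Q b - Q a.
Proof.
apply: (@Rintegral_pos_label _ _ _ (lbm_momentum lr lv)) => s s0.
by rewrite rP// vP// mulrC.
Qed.

Let QN (s : R) : s < 0 -> v s * r s = rhob (- s) * ub (- s) ^+ 2.
Proof. by move=> s0; rewrite rN// vN//; ring. Qed.

Let mQN : measurable_fun (`[0%R, +oo[ : set R) (fun x => rhob x * ub x ^+ 2).
Proof. by apply: measurable_funM => //; exact: measurable_funX. Qed.

Lemma Rintegral_rhob_ub2 (a b : R) : 0 <= a -> a <= b ->
  \int[leb]_(x in `[a, b]) (rhob x * ub x ^+ 2) = Q (- a) - Q (- b).
Proof. exact: (@Rintegral_neg_label _ _ _ (lbm_momentum lr lv) mQN QN). Qed.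

Lemma FfunE (x y : R) : 0 <= y -> Ffun u0 rho0 y x t = act x y.
Proof.
move=> y0; rewrite (actionE _ lr lv) /Ffun.
rewrite (@Rintegral_pos_label _ _ _ (lbm_actionx t lr lv x)) ?signed_integral0 ?subr0//.
move=> s s0; rewrite rP// vP// /free_time /start min_l ?max_l// lerDl//.
Qed.

Lemma GfunE (x tau : R) : 0 <= tau -> Gfun ub rhob tau x t = act x (- tau).
Proof.
move=> tau0; rewrite (actionE _ lr lv) /Gfun.
set d := fun s => _ * r s.
have ld : lbm d by exact: lbm_actionx.
(* The integrand of [G] is the opposite of the reflected density; the orientation of the primitive
   at negative labels cancels this sign. *)
have ld' : lbm (fun s => -1 * d s) by apply: lbm_mul => //; exact: lbm_cst.
rewrite (@Rintegral_neg_label _ (fun s => -1 * d s) _ ld')//.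
- by rewrite oppr0 signed_integral0 !signed_integralZ// mulN1r sub0r opprK.
- apply: measurable_funM => //; apply: measurable_funM => //.
  apply: measurable_funB => //; apply: measurable_funM => //.
  exact: measurable_funB.
move=> s s0; rewrite /d rN// vN// /free_time /start min_r ?max_r//; first by ring.
  exact: ltW.
by rewrite gerDl ltW.
Qed.

Let Pinc := labelP_inc lr r0.
Let cP := labelP_continuous lr.
Let cQ := labelQ_continuous lr lv.
Let cH : continuous H := labelH_continuous lr lv.
Let minP := label_minimizersP lr lv r0 vM v0 ht.

Let P0 : P 0 = 0. Proof. exact: signed_integral0. Qed.
Let Q0 : Q 0 = 0. Proof. exact: signed_integral0. Qed.

(* Comparing two distinct labels would otherwise unfold them down to the
   integrals. *)
Opaque labelP labelQ labelH signed_integral Rintegral.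

(** * Minimizers of [F] and [G], and the velocity they define *)

Definition nonneg_argmin x := argmin_on [set s | 0 <= s] (act x).
Definition nonpos_argmin x := argmin_on [set s | s <= 0] (act x).
Local Notation A0 := nonneg_argmin.
Local Notation A1 := nonpos_argmin.

Let closed_pos : closed [set s : R | 0 <= s]. Proof. exact: closed_ge. Qed.
Let closed_neg : closed [set s : R | s <= 0]. Proof. exact: closed_le. Qed.
Let itv_pos : is_interval [set s : R | 0 <= s].
Proof. by move=> a b /= a0 b0 c /andP[ac _]; exact: le_trans ac. Qed.
Let itv_neg : is_interval [set s : R | s <= 0].
Proof. by move=> a b /= a0 b0 c /andP[_ cb]; exact: le_trans b0. Qed.

Lemma nonneg_argminP (x : R) : 0 <= x -> [/\ A0 x (sup (A0 x)), A0 x (inf (A0 x)) &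
  forall s, A0 x s -> inf (A0 x) <= s <= sup (A0 x)].
Proof. by move=> x0; apply: (argmin_action lr lv r0 vM v0 ht) => //=. Qed.

Lemma nonpos_argminP (x : R) : 0 <= x -> [/\ A1 x (sup (A1 x)), A1 x (inf (A1 x)) &
  forall s, A1 x s -> inf (A1 x) <= s <= sup (A1 x)].
Proof. by move=> x0; apply: (argmin_action lr lv r0 vM v0 ht) => //=. Qed.

Lemma Fmin_argmin (x m : R) : A0 x m -> Fmin u0 rho0 x t = act x m.
Proof.
move=> [m0 minm]; have Fm : [set Ffun u0 rho0 y x t | y in `[0%R, +oo[] (act x m).
  by exists m; rewrite ?FfunE//= in_itv/= andbT.
have lb : lbound [set Ffun u0 rho0 y x t | y in `[0%R, +oo[] (act x m).
  by move=> _ [y /= + <-]; rewrite in_itv/= andbT => y0; rewrite FfunE// minm.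
apply/eqP; rewrite eq_le; apply/andP; split; last by apply: lb_le_inf => //; exists (act x m).
by apply: ge_inf => //; exists (act x m).
Qed.

Lemma Gmin_argmin (x m : R) : A1 x m -> Gmin ub rhob x t = act x m.
Proof.
move=> [m0 minm]; have Gm : [set Gfun ub rhob y x t | y in `[0%R, +oo[] (act x m).
  by exists (- m); rewrite ?GfunE ?oppr_ge0 ?opprK//= in_itv/= andbT oppr_ge0.
have lb : lbound [set Gfun ub rhob y x t | y in `[0%R, +oo[] (act x m).
  move=> _ [y /= + <-]; rewrite in_itv/= andbT => y0; rewrite GfunE// minm//=.
  by rewrite oppr_le0.
apply/eqP; rewrite eq_le; apply/andP; split; last by apply: lb_le_inf => //; exists (act x m).
by apply: ge_inf => //; exists (act x m).
Qed.

Lemma FargminE (x : R) : 0 <= x -> Fargmin u0 rho0 x t = A0 x.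
Proof.
move=> x0; have [[m0 minm] _ _] := nonneg_argminP x0.
rewrite /Fargmin (Fmin_argmin (conj m0 minm)); apply/seteqP; split => y /=.
  by move=> [y0]; rewrite (FfunE x y0) => yE; split=> [|s /minm]; rewrite ?yE.
move=> [y0 miny]; split; first by [].
by rewrite (FfunE x y0); apply/eqP; rewrite eq_le (miny _ m0) (minm _ y0).
Qed.

Lemma GargminE (x : R) : 0 <= x -> Gargmin ub rhob x t = -%R @` A1 x.
Proof.
move=> x0; have [[m0 minm] _ _] := nonpos_argminP x0.
rewrite /Gargmin (Gmin_argmin (conj m0 minm)); apply/seteqP; split => y /=.
  move=> [y0]; rewrite (GfunE x y0) => yE; exists (- y); last by rewrite opprK.
  by split=> [/=|s /minm]; rewrite ?yE ?oppr_le0.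
move=> [s [s0 mins] <-]; have s0' : 0 <= - s by rewrite oppr_ge0.
split; first by [].
by rewrite (GfunE x s0') opprK; apply/eqP; rewrite eq_le (mins _ m0) (minm _ s0).
Qed.

Lemma yhiE (x : R) : 0 <= x -> yhi u0 rho0 x t = sup (A0 x).
Proof. by move=> x0; rewrite /yhi FargminE. Qed.

Lemma yloE (x : R) : 0 <= x -> ylo u0 rho0 x t = inf (A0 x).
Proof. by move=> x0; rewrite /ylo FargminE. Qed.

(** The reflection [tau = - s] exchanges largest and smallest minimizers. *)
Lemma thiE (x : R) : 0 <= x -> thi ub rhob x t = - inf (A1 x).
Proof. by move=> x0; rewrite /thi GargminE// /inf opprK. Qed.

Lemma tloE (x : R) : 0 <= x -> tlo ub rhob x t = - sup (A1 x).
Proof.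
move=> x0; rewrite /tlo GargminE// /inf; congr (- sup _).
rewrite image_comp; apply/seteqP; split => [s [z ? <-]|s ?] /=; rewrite ?opprK//.
by exists s => //=; rewrite opprK.
Qed.

Opaque yhi ylo thi tlo Fmin Gmin.

Let cover_pos : [set s : R | 0 <= s] `|` [set s : R | s <= 0] = setT.
Proof. by apply/seteqP; split => // s _ /=; have [?|/ltW ?] := leP 0 s; [left|right]. Qed.

Let cover_neg : [set s : R | s <= 0] `|` [set s : R | 0 <= s] = setT.
Proof. by rewrite setUC cover_pos. Qed.

Lemma minimizers_lt (x : R) : 0 <= x -> Fmin u0 rho0 x t < Gmin ub rhob x t -> S x = A0 x.
Proof.
move=> x0; have [m _ _] := nonneg_argminP x0; have [m' _ _] := nonpos_argminP x0.
rewrite (Fmin_argmin m) (Gmin_argmin m'); exact: (argmin_split_lt cover_pos m m').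
Qed.

Lemma minimizers_gt (x : R) : 0 <= x -> Gmin ub rhob x t < Fmin u0 rho0 x t -> S x = A1 x.
Proof.
move=> x0; have [m _ _] := nonneg_argminP x0; have [m' _ _] := nonpos_argminP x0.
rewrite (Fmin_argmin m) (Gmin_argmin m'); exact: (argmin_split_lt cover_neg m' m).
Qed.

(** At a tie both families minimize; the nonnegative one supplies the largest label and the
    nonpositive one the smallest. *)
Lemma minimizers_eq (x : R) : 0 <= x -> Fmin u0 rho0 x t = Gmin ub rhob x t ->
  [/\ S x = A0 x `|` A1 x, smax x = yhi u0 rho0 x t & smin x = - thi ub rhob x t].
Proof.
move=> x0; have [m l b] := nonneg_argminP x0; have [m' l' b'] := nonpos_argminP x0.
rewrite (Fmin_argmin m) (Gmin_argmin m') => E.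
have SE : S x = A0 x `|` A1 x by exact: (argmin_split_eq cover_pos m m' E).
have [Sp Sm Sb] := label_minimizersP lr lv r0 vM v0 ht x0.
rewrite (yhiE x0) (thiE x0) opprK; split; first exact: SE.
  all: apply/eqP; rewrite eq_le; apply/andP; split.
- move: Sp; rewrite SE => -[/b/andP[]//|[/= s0 _]].
  by apply: le_trans s0 _; case: m.
- by have /andP[] : smin x <= sup (A0 x) <= smax x by apply: Sb; rewrite SE; left.
- by have /andP[] : smin x <= inf (A1 x) <= smax x by apply: Sb; rewrite SE; right.
- move: Sm; rewrite SE => -[[/= s0 _]|/b'/andP[]//].
  by apply: le_trans s0; case: l'.
Qed.

(** The boundary and initial integrals, both starting from [0], join into a single increment across
    the origin. *)
Lemma u_eE (x : R) : 0 <= x -> u_e u0 ub rho0 rhob x t =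
  (Q (yhi u0 rho0 x t) - Q (- thi ub rhob x t)) /
  (P (yhi u0 rho0 x t) - P (- thi ub rhob x t)).
Proof.
move=> x0; have [[y0 _] _ _] := nonneg_argminP x0; have [_ [s0 _] _] := nonpos_argminP x0.
rewrite /= -yhiE// in y0; rewrite /= -oppr_ge0 -thiE// in s0.
rewrite /u_e; move: (yhi u0 rho0 x t) (thi ub rhob x t) y0 s0 => y s y0 s0.
rewrite (Rintegral_rhob_ub2 (lexx 0) s0) (Rintegral_rhob_ub (lexx 0) s0) (Rintegral_rho0_u0 (lexx 0) y0).
rewrite (Rintegral_rho0 (lexx 0) y0) oppr0 P0 Q0 !sub0r !subr0.
by rewrite [- Q _ + _]addrC [- P _ + _]addrC.
Qed.

Lemma ufunE (x : R) : 0 < x ->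
  ufun u0 ub rho0 rhob x t = velocity P Q H (free_time t) start x.
Proof.
move=> x0; have x0' := ltW x0; rewrite /ufun x0 (u_eE x0') /velocity.
have [m l yb] := nonneg_argminP x0'; have [m' l' sb] := nonpos_argminP x0'.
have y0 : 0 <= ylo u0 rho0 x t by rewrite (yloE x0'); case: l.
have ylh : ylo u0 rho0 x t <= yhi u0 rho0 x t.
  by rewrite (yloE x0') (yhiE x0'); have /andP[] := yb _ m.
have tlh : tlo ub rhob x t <= thi ub rhob x t.
  by rewrite (tloE x0') (thiE x0') lerN2; have /andP[] := sb _ m'.
have tl0 : 0 <= tlo ub rhob x t by rewrite (tloE x0') oppr_ge0; case: m'.
have Elt : Fmin u0 rho0 x t < Gmin ub rhob x t ->
    smax x = yhi u0 rho0 x t /\ smin x = ylo u0 rho0 x t.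
  by move=> /(minimizers_lt x0') E; rewrite /max_label /min_label E (yhiE x0') (yloE x0').
have Egt : Gmin ub rhob x t < Fmin u0 rho0 x t ->
    smax x = - tlo ub rhob x t /\ smin x = - thi ub rhob x t.
  by move=> /(minimizers_gt x0') E; rewrite /max_label /min_label E (tloE x0') (thiE x0') !opprK.
have Eeq : Fmin u0 rho0 x t = Gmin ub rhob x t ->
    smax x = yhi u0 rho0 x t /\ smin x = - thi ub rhob x t.
  by move=> /(minimizers_eq x0')[].
move: (yhi u0 rho0 x t) (ylo u0 rho0 x t) (thi ub rhob x t) (tlo ub rhob x t)
  (Fmin u0 rho0 x t) (Gmin ub rhob x t) (smax x) (smin x) y0 ylh tlh tl0 Elt Egt Eeq.
move=> {m l yb m' l' sb} y1 y s1 s F G p q y0 ylh tlh tl0 Elt Egt Eeq.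
have y10 := le_trans y0 ylh; have s10 := le_trans tl0 tlh.
case: (ltgtP F G) => E.
- have [-> ->] := Elt E; case: eqVneq => [lh|lh].
    by rewrite lh ltxx /start /free_time max_l ?min_l ?lerDl.
  by rewrite lt_neqAle lh ylh/= (Rintegral_rho0_u0 y0 ylh) (Rintegral_rho0 y0 ylh).
- have [-> ->] := Egt E; rewrite ltrN2; case: eqVneq => [lh|lh].
    by rewrite lh ltxx /start /free_time max_r ?min_r ?subr0 ?gerDl ?oppr_le0.
  by rewrite lt_neqAle lh tlh/= (Rintegral_rhob_ub2 tl0 tlh) (Rintegral_rhob_ub tl0 tlh).
have [-> ->] := Eeq E; case: ifPn => [|/norP[/negPn/eqP -> /negPn/eqP ->]].
  (* At a tie the extreme minimizers are [- s1 <= 0 <= y1]; they differ exactly when one of them is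
     nonzero, which is the test in the definition of [u]. *)
  rewrite -negb_and => h; rewrite ifT// lt_neqAle (le_trans _ y10) ?oppr_le0// andbT.
  apply: contra h => /eqP h; have y1E : y1 = 0 by lra.
  by rewrite y1E eqxx -oppr_eq0 h y1E eqxx.
by rewrite oppr0 ltxx /start /free_time max_l// addr0 min_l// subr0.
Qed.

(** Which minimizer occurs depends on the case, but minimizers at different points are ordered, so
    any of them determines the same right limits. *)
Lemma mfun_minimizer (x : R) : 0 < x ->
  exists2 s, S x s & Defs.mfun u0 ub rho0 rhob x t = P s.
Proof.
move=> x0; have x0' := ltW x0; rewrite /Defs.mfun x0/=.
have [_ l _] := nonneg_argminP x0'; have [m _ _] := nonpos_argminP x0'.
have [FG|GF] := leP (Fmin u0 rho0 x t) (Gmin ub rhob x t).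
  exists (inf (A0 x)); last first.
    have l0 : 0 <= inf (A0 x) by case: l.
    by rewrite (yloE x0') (Rintegral_rho0 (lexx 0) l0) P0 subr0.
  move: FG; rewrite le_eqVlt => /predU1P[/(minimizers_eq x0')[-> _ _]|FG].
    by left.
  by rewrite minimizers_lt.
exists (sup (A1 x)); first by rewrite minimizers_gt.
have s0 : 0 <= - sup (A1 x) by rewrite oppr_ge0; case: m.
by rewrite (tloE x0') (Rintegral_rhob_ub (lexx 0) s0) oppr0 P0 opprK sub0r opprK.
Qed.

(** * Behaviour at the origin and the Stieltjes measure of [m] *)

Lemma nonpos_argmin0 (s : R) : A1 0 s -> s = - t.
Proof.
move=> [/= s0 mins]; apply/eqP; apply: contraT => st.
have := action0_boundary lr lv r0 v0 ht s0 st.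
by rewrite ltNge mins//= oppr_le0 ltW.
Qed.

Lemma tlo_origin : tlo ub rhob 0 t = t.
Proof. by rewrite tloE//; have [/nonpos_argmin0 -> _ _] := nonpos_argminP (lexx 0); rewrite opprK. Qed.

Lemma thi_origin : thi ub rhob 0 t = t.
Proof. by rewrite thiE//; have [_ /nonpos_argmin0 -> _] := nonpos_argminP (lexx 0); rewrite opprK. Qed.

Lemma mfun_origin : Defs.mfun u0 ub rho0 rhob 0 t = P (- t).
Proof.
by rewrite /Defs.mfun ltxx/= tlo_origin (Rintegral_rhob_ub (lexx 0) (ltW ht)) oppr0 P0 sub0r opprK.
Qed.

Lemma mfun_bounds (x z : R) : 0 <= x -> x < z ->
  P (smax x) <= Defs.mfun u0 ub rho0 rhob z t <= P (smax z).
Proof.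
move=> x0 xz; have z0 := le_lt_trans x0 xz.
have [s Sz ->] := mfun_minimizer z0.
apply/andP; split; apply: (P_mono Pinc).
  exact: (minimizers_mono Pinc xz (minimizers_smax minP x0) Sz).
exact: (minimizers_le minP (ltW z0) Sz).
Qed.

Lemma Psmax_cvg (x : R) : 0 <= x -> P (smax z) @[z --> x^'+] --> P (smax x).
Proof.
move=> x0; have sx := smax_cvg_right Pinc cP cH minP x0.
exact: (continuous_cvg _ (@cP (smax x)) sx).
Qed.

Lemma mfun_cvg (x : R) : 0 <= x ->
  Defs.mfun u0 ub rho0 rhob z t @[z --> x^'+] --> P (smax x).
Proof.
move=> x0; apply: (@squeeze_cvgr _ _ _ _ (cst (P (smax x))) (fun z => P (smax z))).
- near=> z; apply: mfun_bounds => //.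
- exact: cvg_cst.
- exact: Psmax_cvg.
Unshelve. all: by end_near. Qed.

Lemma m0plusE : m0plus u0 ub rho0 rhob t = P (smax 0).
Proof. by apply: cvg_lim => //; exact: mfun_cvg. Qed.

(** Taking right limits replaces whichever minimizer defines [m] by the largest one; the maximum
    with [0] reflects the constant extension to the left. *)
Lemma rreg_mext (x : R) :
  rreg (mext u0 ub rho0 rhob t) x = P (smax (Num.max x 0)).
Proof.
set y := Num.max x 0; have y0 : 0 <= y by rewrite /y le_max lexx orbT.
have xy : x <= y by rewrite /y le_max lexx.
set E := [set mext u0 ub rho0 rhob t z | z in `]x, +oo[].
have lbE : lbound E (P (smax y)).
  move=> _ [z /= + <-]; rewrite in_itv/= andbT => xz; rewrite /mext.
  have [z0|z0] := ltP 0 z.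
    have yz : y < z by rewrite /y gt_max xz z0.
    by have /andP[] := mfun_bounds y0 yz.
  by rewrite m0plusE /y max_r// (le_trans (ltW xz)).
apply/eqP; rewrite eq_le; apply/andP; split; last first.
  apply: lb_le_inf => //; exists (mext u0 ub rho0 rhob t (y + 1)), (y + 1) => //=.
  by rewrite in_itv/= andbT (le_lt_trans xy)// ltrDl.
apply: (cvgr_to_ge (mfun_cvg y0)); near=> z.
have yz : y < z by [].
apply: ge_inf; first by exists (P (smax y)).
exists z; first by rewrite /= in_itv/= andbT (le_lt_trans xy).
by rewrite /mext (le_lt_trans y0 yz).
Unshelve. all: by end_near. Qed.

Lemma mmeas_itv (a b : R) : 0 <= a -> a <= b ->
  mmeas u0 ub rho0 rhob t `]a, b]%classic = (P (smax b) - P (smax a))%:E.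
Proof.
move=> a0 ab; have b0 := le_trans a0 ab.
have rE : rreg (mext u0 ub rho0 rhob t) = fun x => P (smax (Num.max x 0)).
  by apply/funext => x; exact: rreg_mext.
rewrite /mmeas LSmeasure_itv//; first by rewrite !rreg_mext !max_l.
- rewrite rE => x z xz; apply: (P_mono Pinc); apply: (smax_mono Pinc minP).
    by rewrite le_max lexx orbT.
  by rewrite ge_max !le_max xz lexx orbT.
rewrite rE => x; have [x0|x0] := boolP (0 <= x).
  rewrite max_l//; apply: cvg_trans (Psmax_cvg x0); apply: near_eq_cvg; near=> z.
  have xz : x < z by [].
  by rewrite max_l// (le_trans x0)// ltW.
rewrite -ltNge in x0.
apply: cvg_near_cst; near=> z; rewrite !max_r//; first exact: ltW.
by near: z; exact: nbhs_right_le.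
Unshelve. all: by end_near. Qed.

Lemma smax_seq_unbounded (T : R) : \forall n \near \oo, T <= smax n.+1%:R.
Proof.
have [A [_ hA]] := smax_unbounded Pinc minP T.
near=> n; apply: hA; have : A < n%:R by near: n; exact: nbhs_infty_gtr.
by move/lt_le_trans; apply; rewrite ler_nat.
Unshelve. all: by end_near. Qed.

Transparent yhi ylo thi tlo Fmin Gmin labelP labelQ labelH signed_integral Rintegral.

(** * Balance of total mass and momentum *)

Hypothesis irho0 : leb.-integrable `[0%R, +oo[ (EFin \o rho0).

Lemma Psmax_seq_cvg :
  P (smax n.+1%:R) @[n --> \oo] --> \int[leb]_(x in `[0%R, +oo[) rho0 x.
Proof. exact: (signed_integral_cvg lr rP irho0 smax_seq_unbounded). Qed.

Lemma integrable_momentum :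
  leb.-integrable `[0%R, +oo[ (EFin \o (fun x => rho0 x * u0 x)).
Proof.
have iM : leb.-integrable `[0%R, +oo[ (fun x => M%:E * (EFin \o rho0) x)%E.
  by apply: integrableZl => //; exact: measurable_itv.
apply: le_integrable iM => //.
- exact/measurable_EFinP/measurable_funM.
move=> x; rewrite /= in_itv/= andbT => x0; rewrite lee_fin !normrM mulrC.
by rewrite ler_pM// (le_trans (bu0 x0))// ler_norm.
Qed.

Lemma Qsmax_seq_cvg :
  Q (smax n.+1%:R) @[n --> \oo] --> \int[leb]_(x in `[0%R, +oo[) (rho0 x * u0 x).
Proof.
apply: (signed_integral_cvg (lbm_momentum lr lv) _ integrable_momentum smax_seq_unbounded).
by move=> s s0; rewrite rP// vP// mulrC.
Qed.

Let Pinf := \int[leb]_(x in `[0%R, +oo[) rho0 x.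
Let Qinf := \int[leb]_(x in `[0%R, +oo[) (rho0 x * u0 x).

Lemma mmeas_total :
  mmeas u0 ub rho0 rhob t `]0%R, +oo[%classic = (Pinf - P (smax 0))%:E.
Proof. exact: (mu_gt0_itv mmeas_itv Psmax_seq_cvg). Qed.

Lemma momentum_total :
  (\int[mmeas u0 ub rho0 rhob t]_(x in `]0%R, +oo[) (ufun u0 ub rho0 rhob x t)%:E
   = (Qinf - Q (smax 0))%:E)%E.
Proof.
rewrite -(integral_velocity Pinc cP cQ cH (@free_time_continuous _ t)
  (@start_continuous _) minP (free_time_smax lr lv r0 vM v0 ht)
  (labelQ_le lr lv r0 vM) (labelH_le t lr lv r0 vM) mmeas_itv
  Psmax_seq_cvg Qsmax_seq_cvg).
apply: eq_integral => x; rewrite inE/= in_itv/= andbT => x0.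
by rewrite ufunE.
Qed.

Lemma inflow_mass :
  (\int[leb]_(x in `[0%R, t]) (rhob x * ub x)%:E = (- P (- t)%R)%:E)%E.
Proof.
exact: (integral_neg_labelE lr (measurable_funM mrhob mub) rN (ltW ht)).
Qed.

Lemma inflow_momentum :
  (\int[leb]_(x in `[0%R, t]) (rhob x * ub x ^+ 2)%:E = (- Q (- t)%R)%:E)%E.
Proof. exact: (integral_neg_labelE (lbm_momentum lr lv) mQN QN (ltW ht)). Qed.

Lemma initial_mass : (\int[leb]_(x in `[0%R, +oo[) (rho0 x)%:E = Pinf%:E)%E.
Proof.
have mD : measurable (`[0%R, +oo[%classic : set (measurableTypeR R)).
  exact: measurable_itv.
by rewrite /Pinf /Rintegral fineK//; exact: (integrable_fin_num mD irho0).
Qed.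

Lemma initial_momentum :
  (\int[leb]_(x in `[0%R, +oo[) (rho0 x * u0 x)%:E = Qinf%:E)%E.
Proof.
have mD : measurable (`[0%R, +oo[%classic : set (measurableTypeR R)).
  exact: measurable_itv.
by rewrite /Qinf /Rintegral fineK//; exact: (integrable_fin_num mD integrable_momentum).
Qed.

Opaque labelP labelQ labelH signed_integral Rintegral yhi ylo thi tlo Fmin Gmin.

Lemma smax0_gt : Gmin ub rhob 0 t < Fmin u0 rho0 0 t -> smax 0 = - t.
Proof.
move=> /(minimizers_gt (lexx 0)) E; rewrite /max_label E.
by have [/nonpos_argmin0] := nonpos_argminP (lexx 0).
Qed.

(** The atom at the origin carries the labels between [- t] and [smax 0], the mass missing from the
    open half-line. If [G < F] at the origin, then [smax 0 = - t] and nothing is missing. *)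
Lemma total_massE :
  total_mass u0 ub rho0 rhob t = (Pinf - P (- t))%:E.
Proof.
rewrite /total_mass mmeas_total -EFinD /atom0 m0plusE mfun_origin; congr EFin.
have [_|/smax0_gt ->] := leP (Fmin u0 rho0 0 t) (Gmin ub rhob 0 t).
  by rewrite addrA subrK.
by rewrite addr0.
Qed.

Lemma total_momentum_ge : Gmin ub rhob 0 t <= Fmin u0 rho0 0 t ->
  total_momentum u0 ub rho0 rhob t = (Qinf - Q (- t))%:E.
Proof.
rewrite /total_momentum momentum_total -EFinD /atom0 m0plusE mfun_origin /ufun ltxx => GF.
congr EFin; case: ltgtP GF => // [GF _|FG _].
  by rewrite mulr0 addr0 (smax0_gt GF).
have [_ -> _] := minimizers_eq (lexx 0) (esym FG).
(* At a tie the velocity at the origin times the atom is the momentum of the labels from [- t] to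
   [smax 0]; the mass divided by is positive since [- t < 0 <= yhi]. *)
rewrite (u_eE (lexx 0)) thi_origin divfK ?addrA ?subrK// gt_eqF// subr_gt0; apply: Pinc.
rewrite (lt_le_trans (_ : _ < 0)) ?oppr_lt0//.
by rewrite (yhiE (lexx 0)); have [[]] := nonneg_argminP (lexx 0).
Qed.

(** The atom is at rest, so the momentum of the labels it absorbed is lost. *)
Lemma total_momentum_lt : Fmin u0 rho0 0 t < Gmin ub rhob 0 t ->
  total_momentum u0 ub rho0 rhob t = (Qinf - Q (smax 0))%:E.
Proof.
move=> FG; rewrite /total_momentum momentum_total -EFinD /ufun ltxx.
by rewrite (lt_gtF FG) FG mul0r addr0.
Qed.

Transparent labelP labelQ labelH signed_integral Rintegral yhi ylo thi tlo Fmin Gmin.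

(* Beyond the origin the action dominates [t] times the momentum, and it is
   negative because it is below its value at the label [0]. *)
Lemma Q_smax0_le0 : Fmin u0 rho0 0 t < Gmin ub rhob 0 t -> Q (smax 0) <= 0.
Proof.
move=> /(minimizers_lt (lexx 0)) E.
have [Sp _ _] := minP (lexx 0).
have s0 : 0 <= smax 0 by move: Sp; rewrite E => -[].
have H0 : H 0 = 0 by exact: signed_integral0.
have Hs : H (smax 0) <= 0.
  by case: Sp => _ /(_ 0 I); rewrite !mul0r !subr0 H0.
have ltQ : lbm (fun s => t * (v s * r s)).
  by apply: lbm_mul; [exact: lbm_cst|exact: lbm_momentum].
have : t * Q (smax 0) <= H (smax 0).
  have := signed_integral_le ltQ (lbm_action t lr lv) s0.
  rewrite !(signed_integralZ _ _ (lbm_momentum lr lv)).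
  rewrite -/(labelQ r v) -/(labelH r v t) Q0 H0 mulr0 !subr0; apply.
  move=> s /andP[/ltW s1 _]; rewrite /free_time /start min_l ?lerDl// max_l//.
  by rewrite mulrA ler_pM2r// lerDl.
by move=> /le_trans/(_ Hs); rewrite pmulr_rle0.
Qed.

Lemma Q_inflow_le0 : Q (- t) <= 0.
Proof.
rewrite -oppr_ge0 -lee_fin -inflow_momentum; apply: integral_ge0 => x.
rewrite /= in_itv/= => /andP[x0 _].
by rewrite lee_fin mulr_ge0 ?sqr_ge0// ltW// prhob.
Qed.

End Model.

Theorem theorem4p4 (R : realType) (u0 ub rho0 rhob : R -> R)
  (* u0, ub bounded measurable on [0,oo), ub > 0 *)
  (mu0 : measurable_fun (`[0%R, +oo[ : set R) u0)
  (bu0 : exists M : R, forall x, 0 <= x -> `|u0 x| <= M)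
  (mub : measurable_fun (`[0%R, +oo[ : set R) ub)
  (bub : exists M : R, forall x, 0 <= x -> `|ub x| <= M)
  (pub : forall x, 0 <= x -> 0 < ub x)
  (* rho0, rhob positive, locally bounded, measurable on [0,oo) *)
  (prho0 : forall x, 0 <= x -> 0 < rho0 x)
  (prhob : forall x, 0 <= x -> 0 < rhob x)
  (lbrho0 : forall T : R, exists M : R, forall x, 0 <= x <= T -> `|rho0 x| <= M)
  (lbrhob : forall T : R, exists M : R, forall x, 0 <= x <= T -> `|rhob x| <= M)
  (mrho0 : measurable_fun (`[0%R, +oo[ : set R) rho0)
  (mrhob : measurable_fun (`[0%R, +oo[ : set R) rhob)
  (* rho0 in L^1([0,oo)) *)
  (irho0 : lebesgue_measure.-integrable `[0%R, +oo[ (EFin \o rho0))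
  (t : R) (ht : 0 < t) :
  total_mass u0 ub rho0 rhob t =
    (\int[lebesgue_measure]_(x in `[0%R, +oo[) (rho0 x)%:E
     + \int[lebesgue_measure]_(eta in `[0%R, t]) (rhob eta * ub eta)%:E)%E
  /\
  (Gmin ub rhob 0 t <= Fmin u0 rho0 0 t ->
    total_momentum u0 ub rho0 rhob t =
    (\int[lebesgue_measure]_(x in `[0%R, +oo[) (rho0 x * u0 x)%:E
     + \int[lebesgue_measure]_(eta in `[0%R, t]) (rhob eta * ub eta ^+ 2)%:E)%E)
  /\
  (Fmin u0 rho0 0 t < Gmin ub rhob 0 t ->
    (\int[lebesgue_measure]_(x in `[0%R, +oo[) (rho0 x * u0 x)%:E
     - \int[lebesgue_measure]_(eta in `[0%R, t]) (rhob eta * ub eta ^+ 2)%:E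
     <= total_momentum u0 ub rho0 rhob t)%E).
Proof.
have [M0 hM0] := bu0; have [M1 hM1] := bub.
pose M := Num.max M0 M1.
have b0 (x : R) : 0 <= x -> `|u0 x| <= M by move=> x0; rewrite le_max hM0.
have b1 (x : R) : 0 <= x -> `|ub x| <= M by move=> x0; rewrite le_max hM1 ?orbT.
have hmass := total_massE mu0 b0 mub b1 pub prho0 prhob lbrho0 lbrhob mrho0 mrhob ht irho0.
have hge := total_momentum_ge mu0 b0 mub b1 pub prho0 prhob lbrho0 lbrhob mrho0 mrhob ht irho0.
have hlt := total_momentum_lt mu0 b0 mub b1 pub prho0 prhob lbrho0 lbrhob mrho0 mrhob ht irho0.
have hQ := Q_smax0_le0 mu0 b0 mub b1 pub prho0 prhob lbrho0 lbrhob mrho0 mrhob ht.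
have hQ' := Q_inflow_le0 mu0 b0 mub b1 prhob lbrho0 lbrhob mrho0 mrhob ht.
rewrite (inflow_mass mub b1 lbrho0 lbrhob mrho0 mrhob ht).
rewrite (inflow_momentum mu0 b0 mub b1 lbrho0 lbrhob mrho0 mrhob ht).
rewrite (initial_mass irho0) (initial_momentum mu0 b0 mrho0 irho0) -!EFinD.
split; first exact: hmass.
split; first exact: hge.
(* What remains is [Q (- t) <= - Q (smax 0)], and [0] lies between the two sides. *)
move=> FG; rewrite (hlt FG) lee_fin lerD2l opprK.
by rewrite (le_trans hQ')// oppr_ge0 hQ.
Qed.
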